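(* (i) The set of stationary $L^2$ harmonic solutions of the Euler equations on the hyperbolic plane $\mathbb{H}^2$ contains an infinite-dimensional vector space. (ii) For every $n>2$, there are no (nonzero) stationary $L^2$ harmonic solutions of the Euler equations on the hyperbolic space $\mathbb{H}^n$.
   Context: Let $M$ be a complete Riemannian manifold with Riemannian volume form $\mu$, Levi-Civita covariant derivative $\nabla$, and let $v\mapsto v^\flat$ denote the identification of vector fields with 1-forms via the metric (with inverse $\sharp$). The Euler equations on $M$ are $\partial_t v+\nabla_v v=-\mathrm{grad}\,p$, $\mathrm{div}\,v=0$, for a time-dependent vector field $v$ and function $p$. A steady (stationary) solution is a time-independent divergence-free vector field $v$ such that $\nabla_v v=-\mathrm{grad}\,p$ for some function $p$ on $M$; equivalently, in the Hamiltonian formulation on the dual space $\Omega^1_{L^2}/\overline{d\Omega^0_{L^2}}$ of the Lie algebra of $L^2$ divergence-free vector fields, the Lie derivative $L_v v^\flat$ lies in the $L^2$-closure $\overline{d\Omega^0_{L^2}}$ of differentials of $L^2$ functions. A 1-form $\alpha$ is harmonic if $\Delta\alpha=0$ for the Hodge Laplacian $\Delta=d\delta+\delta d$ (for $L^2$ forms on a complete manifold this is equivalent to $d\alpha=0$ and $\delta\alpha=0$). A stationary $L^2$ harmonic solution is a steady solution $v$ of the Euler equations such that $v^\flat$ is a harmonic 1-form with finite $L^2$ norm $\int_M |v^\flat|^2\,d\mu<\infty$. *)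

(* Defs.v *)
(* Hyperbolic space H^n in the Poincare ball model,
   with all Riemannian operations written in the global coordinate chart. *)
From HB Require Import structures.
From mathcomp Require Import all_boot all_order all_algebra.
From mathcomp Require Import all_classical all_reals all_analysis.
Set Implicit Arguments. Unset Strict Implicit. Unset Printing Implicit Defensive.
Import Order.TTheory GRing.Theory Num.Theory.
Import numFieldNormedType.Exports.
Local Open Scope classical_set_scope.
Local Open Scope ring_scope.

(* n-fold iterated Lebesgue integral over R^n of an extended-real function
   (used only for nonnegative integrands, where by Tonelli it is the
   Lebesgue integral over R^n). *)
Fixpoint iint (R : realType) (n : nat) : ('rV[R]_n -> \bar R) -> \bar R :=
  match n with
  | 0 => fun f => f 0
  | m.+1 => fun f =>
      (\int[@lebesgue_measure R]_(t in setT)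
         iint (fun y : 'rV[R]_m => f (row_mx (\row_(j < 1) t) y)))%E
  end.

Section Riemannian.
Variable R : realType.
Variable n : nat.
Local Notation pt := 'rV[R]_n.

Definition ej (i : 'I_n) : pt := delta_mx 0 i.
Definition pd (i : 'I_n) (f : pt -> R) : pt -> R := fun x => derive f x (ej i).

Definition smooth_on (U : set pt) (f : pt -> R) : Prop :=
  forall (l : seq 'I_n) (x : pt), U x -> differentiable (foldr pd f l) x.

(* ---- the hyperbolic space H^n : Poincare ball with metric 4|dx|^2/(1-|x|^2)^2 *)
Definition sqnorm (x : pt) : R := \sum_(i < n) x 0 i ^+ 2.
Definition ball_model : set pt := [set x | sqnorm x < 1].
Definition hypg (x : pt) : 'M[R]_n := ((2 / (1 - sqnorm x)) ^+ 2) *: 1%:M.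

Variable g : pt -> 'M[R]_n.
Definition ginv (x : pt) : 'M[R]_n := invmx (g x).
Definition vol (x : pt) : R := Num.sqrt (\det (g x)).

Definition christoffel (k i j : 'I_n) (x : pt) : R :=
  2^-1 * \sum_(l < n) ginv x k l *
    (pd i (fun y => g y j l) x + pd j (fun y => g y i l) x
     - pd l (fun y => g y i j) x).

(* vector fields and 1-forms are maps pt -> 'rV_n (components) *)
Definition comp (v : pt -> 'rV[R]_n) (i : 'I_n) : pt -> R := fun x => v x 0 i.

Definition covd (v w : pt -> 'rV[R]_n) : pt -> 'rV[R]_n := fun x =>
  \row_k (\sum_(i < n) v x 0 i * pd i (comp w k) x
          + \sum_(i < n) \sum_(j < n) christoffel k i j x * v x 0 i * w x 0 j).

Definition grad (p : pt -> R) : pt -> 'rV[R]_n := fun x =>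
  \row_k \sum_(l < n) ginv x k l * pd l p x.

Definition divg (v : pt -> 'rV[R]_n) : pt -> R := fun x =>
  (vol x)^-1 * \sum_(i < n) pd i (fun y => vol y * v y 0 i) x.

Definition flat (v : pt -> 'rV[R]_n) : pt -> 'rV[R]_n := fun x =>
  \row_i \sum_(j < n) g x i j * v x 0 j.
Definition sharp (a : pt -> 'rV[R]_n) : pt -> 'rV[R]_n := fun x =>
  \row_i \sum_(j < n) ginv x i j * a x 0 j.

Definition d0 (f : pt -> R) : pt -> 'rV[R]_n := fun x => \row_j pd j f x.
Definition d1 (a : pt -> 'rV[R]_n) : pt -> 'M[R]_n := fun x =>
  \matrix_(i, j) (pd i (comp a j) x - pd j (comp a i) x).
Definition codiff1 (a : pt -> 'rV[R]_n) : pt -> R := fun x => - divg (sharp a) x.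
(* (delta b)_j = - nabla^i b_ij, lowered from (delta b)^j = -(1/vol) d_i (vol b^ij) *)
Definition codiff2 (b : pt -> 'M[R]_n) : pt -> 'rV[R]_n := fun x =>
  \row_j \sum_(m < n) g x j m *
    (- (vol x)^-1 * \sum_(i < n)
        pd i (fun y => vol y * \sum_(a < n) \sum_(c < n)
                         ginv y i a * ginv y m c * b y a c) x).

Definition hodge_lap1 (a : pt -> 'rV[R]_n) : pt -> 'rV[R]_n := fun x =>
  d0 (codiff1 a) x + codiff2 (d1 a) x.

Definition harmonic1 (U : set pt) (a : pt -> 'rV[R]_n) : Prop :=
  forall x, U x -> hodge_lap1 a x = 0.

Definition gnorm2 (v : pt -> 'rV[R]_n) (x : pt) : R :=
  \sum_(i < n) \sum_(j < n) g x i j * v x 0 i * v x 0 j.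

(* int_U |v^flat|^2 dmu < oo  (|v^flat|^2 = |v|^2) *)
Definition L2 (U : set pt) (v : pt -> 'rV[R]_n) : Prop :=
  (iint (fun x => if `[< U x >] then (gnorm2 v x * vol x)%:E else 0%E) < +oo)%E.

Definition steady (U : set pt) (v : pt -> 'rV[R]_n) : Prop :=
  (forall i, smooth_on U (comp v i)) /\
  (forall x, U x -> divg v x = 0) /\
  exists p : pt -> R, (forall x, U x -> differentiable p x) /\
    (forall x, U x -> covd v v x = - grad p x).

Definition stationary_L2_harmonic (U : set pt) (v : pt -> 'rV[R]_n) : Prop :=
  steady U v /\ harmonic1 U (flat v) /\ L2 U v.

End Riemannian.

Definition hyp_sol (R : realType) (n : nat) (v : 'rV[R]_n -> 'rV[R]_n) : Prop :=
  stationary_L2_harmonic (@hypg R n) (@ball_model R n) v.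

(* Main.v *)
(** In the plane the energy of a 1-form is conformally invariant, so the forms
    [Re (z ^ k dz)], bounded and harmonic on the Euclidean disc, are L2 and
    harmonic on the hyperbolic plane; being locally gradients of harmonic
    functions, they solve the Euler equation with pressure [- |v|^2 / 2].

    For [n > 2], a divergence-free form with [delta d a = 0] is first shown to be
    closed: integrating [delta d a] against [a], cut off by a function of small
    hyperbolic gradient, bounds the energy of [d a] by an arbitrarily small
    multiple of that of [a].  For a closed and coclosed form the energy-momentum
    tensor is divergence free; contracting it with the radial field
    [(1 - |x|^2) x] gives a Pohozaev identity whose bulk term is, for
    [n > 2], bounded above by [- (1 - |x|^2) |a|^2 / 2] and whose boundary term
    tends to [0] because [a] is L2.  Hence [a = 0].

    Integrals of continuous functions are iterated integrals over [-1, 1]^n, which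
    bound from below the iterated Lebesgue integral of any function above them. *)
Require Import Defs.
From HB Require Import structures.
From mathcomp Require Import all_boot all_order all_algebra.
From mathcomp Require Import all_classical all_reals all_analysis.
From mathcomp Require Import ring lra.
Set Implicit Arguments. Unset Strict Implicit. Unset Printing Implicit Defensive.
Import Order.TTheory GRing.Theory Num.Theory.
Import numFieldNormedType.Exports.
Local Open Scope classical_set_scope.
Local Open Scope ring_scope.

(** * Integrals of continuous functions over an interval *)

(** Near the sphere at infinity only a finite energy is known, so each integration by parts is made
    against a power of a compactly supported cutoff. The Euclidean gradient of that cutoff carries a
    factor [1 / (1 - |x|^2)], and cancelling it shapes both vanishing arguments. For the closedness
    of [a], the weight of [|da|^2] has two more factors [1 - |x|^2] than the weight of [|a|^2], and
    these absorb the square of the singular factor. In the Pohozaev identity the field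
    [(1 - |x|^2) x] is chosen for the same reason: its hyperbolic length is [2 |x|], hence bounded,
    so the cutoff term is at most a multiple of [e] times the energy. In the bulk term, the
    coefficient of [- |a|^2] is [(n - 2) (1 + |x|^2) / 2 - |x|^2]. It exceeds [(1 - |x|^2) / 2] by
    [(n - 3) (1 + |x|^2) / 2], which is nonnegative from [n = 3] on; for [n = 2] the coefficient is
    [- |x|^2] and the argument breaks down, as it must. *)

Section ContinuousOps.
Variables (R : realType) (T : topologicalType).
Implicit Types f g : T -> R.

Lemma continuous_addf f g : continuous f -> continuous g ->
  continuous (fun x => f x + g x).
Proof. by move=> cf cg x; apply: continuousD; [exact: cf|exact: cg]. Qed.

Lemma continuous_mulf f g : continuous f -> continuous g ->
  continuous (fun x => f x * g x).
Proof. by move=> cf cg x; apply: continuousM; [exact: cf|exact: cg]. Qed.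

Lemma continuous_sumf (I : Type) (r : seq I) (P : pred I) (f : I -> T -> R) :
  (forall i, P i -> continuous (f i)) ->
  continuous (fun x => \sum_(i <- r | P i) f i x).
Proof.
move=> cf; elim: r => [|i r IH].
  by under eq_fun do rewrite big_nil; exact: cst_continuous.
under eq_fun do rewrite big_cons; case: (boolP (P i)) => // Pi.
exact: continuous_addf (cf i Pi) IH.
Qed.

End ContinuousOps.

Section OneDim.
Variable R : realType.
Local Notation mu := (@lebesgue_measure R).

Definition int1 (g : R -> R) : R := \int[mu]_(t in `[-1, 1]) g t.

Lemma continuous_integrable (g : R -> R) (a b : R) :
  continuous g -> mu.-integrable `[a, b] (EFin \o g).
Proof.
move=> cg; apply: continuous_compact_integrable; first exact: segment_compact.
exact: continuous_subspaceT.
Qed.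

Lemma int1D (f g : R -> R) : continuous f -> continuous g ->
  int1 (fun t => f t + g t) = int1 f + int1 g.
Proof. by move=> cf cg; rewrite /int1 RintegralD //; try exact: continuous_integrable. Qed.

Lemma int1Z (k : R) (f : R -> R) : continuous f ->
  int1 (fun t => k * f t) = k * int1 f.
Proof. by move=> cf; rewrite /int1 RintegralZl //; try exact: continuous_integrable. Qed.

Lemma int1_le (f g : R -> R) : continuous f -> continuous g ->
  (forall t, -1 <= t <= 1 -> f t <= g t) -> int1 f <= int1 g.
Proof.
move=> cf cg fg; apply: le_Rintegral => //; try exact: continuous_integrable.
Qed.

Lemma int1_cst (k : R) : int1 (fun=> k) = 2 * k.
Proof.
rewrite /int1 Rintegral_cst //= lebesgue_measure_itv /= lte_fin.
by rewrite ifT /=; [ring|lra].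
Qed.

Lemma int1_deriv (F f : R -> R) : continuous f ->
  (forall t : R, is_derive t 1 F (f t)) -> int1 f = F 1 - F (-1).
Proof.
move=> cf dF; rewrite /int1 /Rintegral.
rewrite (@continuous_FTC2 _ f F) ?fineD //.
- exact: continuous_subspaceT.
- have cF : continuous F.
    by move=> t; apply/differentiable_continuous/derivable1_diffP; case: (dF t).
  split.
  + by move=> t _; case: (dF t).
  + exact/cvg_at_right_filter/cF.
  + exact/cvg_at_left_filter/cF.
- by move=> t _; rewrite derive1E; case: (dF t).
Qed.

(** The primitive starting at [-1] is squeezed between [0] and the full integral, so it is constant;
    its derivative is [f]. *)
Lemma int1_eq0 (f : R -> R) : continuous f ->
  (forall t, -1 <= t <= 1 -> 0 <= f t) -> int1 f = 0 ->
  forall t, -1 < t < 1 -> f t = 0.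
Proof.
move=> cf f0 If t /andP[t1 t2].
pose F x := \int[mu]_(u in `[-1, x]) f u.
have F0 x : -1 <= x <= 1 -> F x = 0.
  move=> /andP[x1 x2]; apply/eqP; rewrite eq_le; apply/andP; split; last first.
    apply: Rintegral_ge0 => u /=; rewrite in_itv /= => /andP[u1 u2].
    by apply: f0; rewrite u1 (le_trans u2).
  rewrite -If /int1 /F /Rintegral; apply: fine_le.
  - exact/integrable_fin_num/continuous_integrable.
  - exact/integrable_fin_num/continuous_integrable.
  - apply: ge0_subset_integral => //.
    + exact: (measurable_int mu (@continuous_integrable f (-1) 1 cf)).
    + by apply: subset_itvl; rewrite bnd_simp.
have [_ <-] := @continuous_FTC1_closed R f (-1) t 1 t2 (@continuous_integrable _ _ _ cf) t1 (cf t).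
rewrite derive1E -(@near_eq_derive _ _ _ (cst 0)) ?derive_cst //.
near=> x; rewrite /= -[LHS](F0 x) //.
near: x.
have : t \in `]-1, 1[ by rewrite in_itv /= t1.
move=> /near_in_itvoo; apply: filterS => x; rewrite in_itv /= => /andP[x1 x2].
by rewrite !ltW.
Unshelve. all: by end_near. Qed.

(* No measurability is assumed of [h]: a Lebesgue integral is a supremum over simple functions. *)
Lemma ge0_integral_mono (f h : R -> \bar R) : (forall t, (0 <= f t)%E) ->
  (forall t, (f t <= h t)%E) ->
  (\int[mu]_(t in setT) f t <= \int[mu]_(t in setT) h t)%E.
Proof.
move=> f0 fh; have h0 t : (0 <= h t)%E by exact: le_trans (fh t).
rewrite !ge0_integralTE //; apply: ge_ereal_sup => _ /= [k kf <-].
by apply: ereal_sup_ubound; exists k => // x; exact: le_trans (fh x).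
Qed.

Lemma int1_le_integral (f : R -> R) (h : R -> \bar R) : continuous f ->
  (forall t, (0 <= h t)%E) ->
  (forall t, -1 <= t <= 1 -> 0 <= f t) ->
  (forall t, -1 <= t <= 1 -> ((f t)%:E <= h t)%E) ->
  ((int1 f)%:E <= \int[mu]_(t in setT) h t)%E.
Proof.
move=> cf h0 f0 fh; rewrite /int1 /Rintegral fineK; last first.
  exact/integrable_fin_num/continuous_integrable.
rewrite integral_mkcond; apply: ge0_integral_mono => t.
  by apply: erestrict_ge0 => u /= uI; rewrite lee_fin; apply: f0; rewrite in_itv in uI.
rewrite patchE; case: ifPn => // /set_mem /=.
by rewrite in_itv /=; exact: fh.
Qed.

End OneDim.

(** * Iterated integrals over a cube *)

Section CubeIntegral.
Variable R : realType.

Definition cube n : set 'rV[R]_n := [set x | forall i, -1 <= x 0 i <= 1].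

Lemma cube_compact n : compact (@cube n).
Proof.
have -> : @cube n = [set x : 'rV[R]_n | forall i, `[(-1 : R), 1]%classic (x ord0 i)].
  by apply/seteqP; split => x /= xc i; have := xc i; rewrite /= in_itv.
by apply: (@rV_compact R n (fun=> `[(-1 : R), 1]%classic)) => i; exact: segment_compact.
Qed.

(** The expression that occurs inside [iint], so that [cint] and [iint] unfold along the same
    slices. *)
Definition vcons m (t : R) (y : 'rV[R]_m) : 'rV[R]_m.+1 :=
  row_mx (\row_(j < 1) t) y.

Lemma vcons0 m t (y : 'rV[R]_m) : vcons t y 0 ord0 = t.
Proof.
have -> : ord0 = lshift m (ord0 : 'I_1) by exact: val_inj.
by rewrite [LHS]row_mxEl mxE.
Qed.

Lemma vconsS m t (y : 'rV[R]_m) i : vcons t y 0 (rshift 1 i) = y 0 i.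
Proof. exact: row_mxEr. Qed.

Lemma ord_consP m (P : 'I_m.+1 -> Prop) :
  P ord0 -> (forall i : 'I_m, P (rshift 1 i)) -> forall i, P i.
Proof.
move=> P0 PS i; case: (unliftP ord0 i) => [j ->|-> //].
by rewrite (_ : lift ord0 j = rshift 1 j) //; apply: val_inj.
Qed.

Lemma vcons_surj m (x : 'rV[R]_m.+1) :
  exists t y, x = vcons t y /\ t = x 0 ord0 /\ forall i, y 0 i = x 0 (rshift 1 i).
Proof.
exists (x 0 ord0), (\row_i x 0 (rshift 1 i)); split; last by split => // i; rewrite mxE.
apply/rowP; apply: ord_consP => [|i]; first by rewrite vcons0.
by rewrite vconsS mxE.
Qed.

Lemma cube_vcons m t (y : 'rV[R]_m) : -1 <= t <= 1 -> cube y -> cube (vcons t y).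
Proof.
by move=> t1 cy; apply: ord_consP => [|i]; rewrite ?vcons0 ?vconsS //; exact: cy.
Qed.

Lemma vcons_near m t (y : 'rV[R]_m) (P : set 'rV[R]_m.+1) :
  nbhs (vcons t y) P -> \forall y' \near y & t' \near t, P (vcons t' y').
Proof.
move=> /nbhs_ballP [e e0 eP].
exists (ball y e, ball t e) => /=.
  by split; exact: nbhsx_ballx.
move=> [y' t'] /= [[_ yy'] tt']; apply: eP; split => // i; rewrite ord1.
by apply: ord_consP => [|j]; rewrite ?vcons0 ?vconsS.
Qed.

Lemma continuous_vconsr m (f : 'rV[R]_m.+1 -> R) t :
  continuous f -> continuous (fun y => f (vcons t y)).
Proof.
move=> cf y A /cf /vcons_near [[P Q] /= [yP tQ] PQ].
apply: filterS yP => z Pz; apply: (PQ (z, t)); split => //=.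
exact: nbhs_singleton.
Qed.

Lemma continuous_vconsl m (f : 'rV[R]_m.+1 -> R) y :
  continuous f -> continuous (fun t => f (vcons t y)).
Proof.
move=> cf t A /cf /vcons_near [[P Q] /= [yP tQ] PQ].
apply: filterS tQ => z Pz; apply: (PQ (y, z)); split => //=.
exact: nbhs_singleton.
Qed.

(** Compactness of the cube makes continuity in [t] uniform in [y]. Continuity of slice integrals
    and differentiation under the integral sign both rest on this. *)
Lemma cube_unif m (f : 'rV[R]_m.+1 -> R) (t e : R) : continuous f -> 0 < e ->
  \forall t' \near t, forall y : 'rV[R]_m, cube y ->
    `|f (vcons t' y) - f (vcons t y)| <= e.
Proof.
move=> cf e0.
have /compact_near_coveringP/(_ R (nbhs t)
  (fun t' y => `|f (vcons t' y) - f (vcons t y)| <= e)) := @cube_compact m.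
apply => y cy /=.
have e20 : 0 < e / 2 by rewrite divr_gt0.
have /vcons_near near1 : nbhs (vcons t y) [set x | `|f (vcons t y) - f x| < e / 2].
  by move/cvgrPdist_lt : (cf (vcons t y)); apply.
have [[P Q] /= [yP tQ] PQ] := near1.
exists (P, Q) => // -[y' t'] /= [Py' Qt'].
have H1 := PQ (y', t') (conj Py' Qt').
have H2 := PQ (y', t) (conj Py' (nbhs_singleton tQ)).
rewrite (_ : f _ - f _ = (f (vcons t y) - f (vcons t y')) - (f (vcons t y) - f (vcons t' y'))); last by ring.
by rewrite (le_trans (ler_normB _ _)) // (splitr e) lerD // ltW.
Qed.

Fixpoint cint n : ('rV[R]_n -> R) -> R :=
  match n with
  | 0 => fun f => f 0
  | m.+1 => fun f => int1 (fun t => cint (fun y : 'rV[R]_m => f (vcons t y)))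
  end.

(** The laws are bundled because they climb one dimension together: the laws of [int1] ask for
    continuous slice integrals, and that continuity is deduced from the laws one dimension below. *)
Record cint_spec n : Prop := CintSpec {
  cint_spD : forall f g : 'rV[R]_n -> R, continuous f -> continuous g ->
    cint (fun x => f x + g x) = cint f + cint g;
  cint_spZ : forall k (f : 'rV[R]_n -> R), continuous f ->
    cint (fun x => k * f x) = k * cint f;
  cint_sp_le : forall f g : 'rV[R]_n -> R, continuous f -> continuous g ->
    (forall x, cube x -> f x <= g x) -> cint f <= cint g;
  cint_sp_cst : forall k, cint (fun _ : 'rV[R]_n => k) = 2 ^+ n * k }.

Lemma cint_spec_dist n (f g : 'rV[R]_n -> R) (e : R) : cint_spec n ->
  continuous f -> continuous g ->
  (forall x, cube x -> `|f x - g x| <= e / 2 ^+ n) -> `|cint f - cint g| <= e.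
Proof.
move=> [HD HZ Hle Hc].
have key (u v : 'rV[R]_n -> R) : continuous u -> continuous v ->
    (forall y : 'rV[R]_n, cube y -> u y <= v y + e / 2 ^+ n) ->
    cint u <= cint v + e.
  move=> cu cv uv.
  have -> : e = cint (fun _ : 'rV[R]_n => e / 2 ^+ n).
    by rewrite Hc mulrCA mulfV ?mulr1 // expf_neq0.
  rewrite -HD //; last exact: cst_continuous.
  by apply: Hle => //; apply: continuous_addf => //; exact: cst_continuous.
move=> cf cg fg.
have k1 : cint f <= cint g + e.
  by apply: key => // y /fg; rewrite ler_norml; set e' := e / _; lra.
have k2 : cint g <= cint f + e.
  by apply: key => // y /fg; rewrite ler_norml; set e' := e / _; lra.
by rewrite ler_norml; apply/andP; split; lra.
Qed.

Lemma cint_spec_continuous n (f : 'rV[R]_n.+1 -> R) : cint_spec n ->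
  continuous f -> continuous (fun t => cint (fun y => f (vcons t y))).
Proof.
move=> Hn cf t; apply/cvgrPdist_le => /= e e0.
have e'0 : 0 < e / 2 ^+ n by rewrite divr_gt0 // exprn_gt0.
have near1 := @cube_unif n f t _ cf e'0.
have ct t' := @continuous_vconsr n f t' cf.
near=> t'; apply: cint_spec_dist => // y cy; rewrite distrC; move: y cy.
by near: t'.
Unshelve. all: by end_near. Qed.

Lemma cintP n : cint_spec n.
Proof.
elim: n => [|n IH].
  split => //= [f g _ _ fg|k]; last by rewrite mul1r.
  by apply: fg => -[].
have Hk f := @cint_spec_continuous n f IH.
case: IH => HD HZ Hle Hc; split => /=.
- move=> f g cf cg; rewrite -int1D; [|exact: Hk|exact: Hk].
  by congr int1; apply/funext => t; rewrite HD //; exact: continuous_vconsr.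
- move=> k f cf; rewrite -int1Z; last exact: Hk.
  by congr int1; apply/funext => t; rewrite HZ //; exact: continuous_vconsr.
- move=> f g cf cg fg; apply: int1_le; [exact: Hk|exact: Hk|move=> t t1].
  apply: Hle; [exact: continuous_vconsr|exact: continuous_vconsr|move=> y cy].
  by apply: fg; exact: cube_vcons.
- move=> k; under eq_fun do rewrite Hc.
  by rewrite int1_cst exprS mulrA.
Qed.

Lemma cintD n (f g : 'rV[R]_n -> R) : continuous f -> continuous g ->
  cint (fun x => f x + g x) = cint f + cint g.
Proof. exact: cint_spD (cintP n) _ _. Qed.

Lemma cintZ n k (f : 'rV[R]_n -> R) : continuous f ->
  cint (fun x => k * f x) = k * cint f.
Proof. exact: cint_spZ (cintP n) _ _. Qed.

Lemma cint_le n (f g : 'rV[R]_n -> R) : continuous f -> continuous g ->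
  (forall x, cube x -> f x <= g x) -> cint f <= cint g.
Proof. exact: cint_sp_le (cintP n) _ _. Qed.

Lemma cint_cst n k : cint (fun _ : 'rV[R]_n => k) = 2 ^+ n * k.
Proof. exact: cint_sp_cst (cintP n) _. Qed.

Lemma cint_continuous n (f : 'rV[R]_n.+1 -> R) :
  continuous f -> continuous (fun t => cint (fun y => f (vcons t y))).
Proof. exact: cint_spec_continuous (cintP n). Qed.

Lemma cint_ge0 n (f : 'rV[R]_n -> R) : continuous f ->
  (forall x, cube x -> 0 <= f x) -> 0 <= cint f.
Proof.
move=> cf f0; rewrite -[0](mulr0 (2 ^+ n)) -cint_cst; apply: cint_le => //.
exact: cst_continuous.
Qed.

Lemma cint_eq0 n (f : 'rV[R]_n -> R) : continuous f ->
  (forall x, cube x -> 0 <= f x) -> cint f = 0 ->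
  forall x : 'rV[R]_n, (forall i, -1 < x 0 i < 1) -> f x = 0.
Proof.
elim: n f => [|n IH] f cf f0 If x xI.
  by move: If => /=; congr (f _ = _); apply/rowP => -[].
have [t [y [xE [tE yE]]]] := vcons_surj x; rewrite xE.
have /= It := @int1_eq0 R _ (cint_continuous cf) _ If t.
apply: (IH (fun y => f (vcons t y))).
- exact: continuous_vconsr.
- move=> z cz; apply: f0; apply: cube_vcons => //; rewrite tE.
  by have /andP[? ?] := xI ord0; rewrite !ltW.
- apply: It; last by rewrite tE; exact: xI.
  move=> s s1; apply: cint_ge0; first exact: continuous_vconsr.
  by move=> z cz; apply: f0; exact: cube_vcons.
- by move=> i; rewrite yE; exact: xI.
Qed.

Lemma iint_ge0 n (h : 'rV[R]_n -> \bar R) : (forall x, (0 <= h x)%E) ->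
  (0 <= iint h)%E.
Proof.
elim: n h => [|n IH] h h0 /=; first exact: h0.
by apply: integral_ge0 => t _; apply: IH.
Qed.

Lemma cint_le_iint n (f : 'rV[R]_n -> R) (h : 'rV[R]_n -> \bar R) :
  continuous f -> (forall x, (0 <= h x)%E) ->
  (forall x, cube x -> 0 <= f x) ->
  (forall x, cube x -> ((f x)%:E <= h x)%E) -> ((cint f)%:E <= iint h)%E.
Proof.
elim: n f h => [|n IH] f h cf h0 f0 fh /=; first by apply: fh => -[].
apply: int1_le_integral.
- exact: cint_continuous.
- by move=> t; apply: iint_ge0.
- move=> t t1; apply: cint_ge0; first exact: continuous_vconsr.
  by move=> y cy; apply: f0; exact: cube_vcons.
- move=> t t1; apply: IH => [|//|y cy|y cy].
  + exact: continuous_vconsr.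
  + by apply: f0; exact: cube_vcons.
  + by apply: fh; exact: cube_vcons.
Qed.

Lemma shift_ej n h (i j : 'I_n) (x : 'rV[R]_n) :
  (h *: ej R i + x) 0 j = h * (j == i)%:R + x 0 j.
Proof. by rewrite [LHS]mxE; congr (_ + _); rewrite !mxE eqxx. Qed.

Lemma vcons_shift0 m h t (y : 'rV[R]_m) :
  h *: ej R ord0 + vcons t y = vcons (h + t) y.
Proof.
apply/rowP; apply: ord_consP => [|i]; rewrite shift_ej ?vcons0 ?vconsS /=.
  by rewrite mulr1.
by rewrite mulr0 add0r.
Qed.

Lemma vcons_shiftS m h t (y : 'rV[R]_m) i :
  h *: ej R (rshift 1 i) + vcons t y = vcons t (h *: ej R i + y).
Proof.
apply/rowP; apply: ord_consP => [|j]; rewrite shift_ej ?vcons0 ?vconsS /=.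
  by rewrite mulr0 add0r.
by rewrite shift_ej (inj_eq (@rshift_inj 1 m)).
Qed.

Lemma vcons_derive0 m (F : 'rV[R]_m.+1 -> R) t y :
  derivable F (vcons t y) (ej R ord0) ->
  is_derive t 1 (fun s => F (vcons s y)) (pd ord0 F (vcons t y)).
Proof.
have E h : vcons (h *: 1 + t) y = h *: ej R ord0 + vcons t y.
  by rewrite vcons_shift0 [h *: 1]mulr1.
move=> dF; apply: DeriveDef; first by rewrite /derivable; under eq_fun do rewrite /= E.
by rewrite /pd /derive; congr (lim (_ @ 0^')); apply/funext => h /=; rewrite E.
Qed.

Lemma vcons_pdS m (F : 'rV[R]_m.+1 -> R) t y i :
  pd (rshift 1 i) F (vcons t y) = pd i (fun z => F (vcons t z)) y.
Proof. by rewrite /pd /derive; congr (lim (_ @ 0^')); apply/funext => h /=; rewrite vcons_shiftS. Qed.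

Lemma vcons_derivableS m (F : 'rV[R]_m.+1 -> R) t y i :
  derivable F (vcons t y) (ej R (rshift 1 i)) ->
  derivable (fun z => F (vcons t z)) y (ej R i).
Proof. by rewrite /derivable; under eq_fun do rewrite /= vcons_shiftS. Qed.

(** For the first coordinate, differentiation under the integral sign and the fundamental theorem of
    calculus leave the values on two opposite faces, which vanish. For any other coordinate each
    slice integral is already zero, by induction. *)
Lemma cint_pd n i (F : 'rV[R]_n -> R) :
  continuous F -> (forall x, derivable F x (ej R i)) -> continuous (pd i F) ->
  (forall x : 'rV[R]_n, x 0 i = -1 \/ x 0 i = 1 -> F x = 0) ->
  cint (pd i F) = 0.
Proof.
elim: n i F => [[] //|n IH]; apply: ord_consP => [|i] F cF dF cdF F0 /=.
  pose Phi t := cint (fun y => F (vcons t y)).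
  have Phi0 t : t = -1 \/ t = 1 -> Phi t = 0.
    move=> t1; rewrite /Phi (_ : (fun y => _) = fun=> 0) ?cint_cst ?mulr0 //.
    by apply/funext => y; apply: F0; rewrite vcons0.
  suff dPhi (t : R) : is_derive t 1 Phi (cint (fun y => pd ord0 F (vcons t y))).
    rewrite (int1_deriv (cint_continuous cdF) dPhi).
    by rewrite !Phi0 ?subrr //; [left|right].
  pose L := cint (fun y => pd ord0 F (vcons t y)).
  suff cvg : (fun h => h^-1 *: (Phi (h *: 1 + t) - Phi t)) @ 0^' --> L.
    by apply: DeriveDef; [apply/cvg_ex; exists L|exact/cvg_lim].
  apply/cvgrPdist_le => e e0.
  have e'0 : 0 < e / 2 ^+ n by rewrite divr_gt0 // exprn_gt0.
  have [/= d d0 dP] := @cube_unif n (pd ord0 F) t _ cdF e'0.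
  have c1 s := @continuous_vconsr n F s cF.
  have c2 := @continuous_vconsr n (pd ord0 F) t cdF.
  exists d => // h /=; rewrite sub0r normrN => hd h0.
  have dFy y s := @vcons_derive0 _ F s y (dF (vcons s y)).
  have key y : cube y ->
      `|pd ord0 F (vcons t y) - h^-1 * (F (vcons (h + t) y) - F (vcons t y))| <= e / 2 ^+ n.
    move=> cy; have cFy := @continuous_vconsl n F y cF.
    (* The mean value theorem, applied for either sign of [h], turns the difference quotient into a
       value of the derivative at distance less than [d] from [t], where the uniform estimate
       applies. *)
    have [c ct cE] : exists2 c, `|t - c| < d &
        F (vcons (h + t) y) - F (vcons t y) = pd ord0 F (vcons c y) * h.
      case: (ltrgt0P h) h0 => // [hp|hn] _.
        have [||c] := @MVT_segment _ _ (fun s => pd ord0 F (vcons s y)) t (h + t) _ (fun s _ => dFy y s).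
        - lra.
        - exact: continuous_subspaceT.
        rewrite in_itv /= => /andP[u1 u2] ->; exists c; last by ring.
        by move: hd; rewrite gtr0_norm // ltr_norml; lra.
      have [||c] := @MVT_segment _ _ (fun s => pd ord0 F (vcons s y)) (h + t) t _ (fun s _ => dFy y s).
      - lra.
      - exact: continuous_subspaceT.
      rewrite in_itv /= => /andP[u1 u2] /(congr1 -%R); rewrite opprB => ->.
      exists c; last by ring.
      by move: hd; rewrite ltr0_norm // ltr_norml; lra.
    by rewrite cE mulrCA mulVf // mulr1 distrC; exact: dP.
  have -> : h^-1 *: (Phi (h *: 1 + t) - Phi t) =
      cint (fun y => h^-1 * (F (vcons (h + t) y) + (-1) * F (vcons t y))).
    have c3 : continuous (fun y => -1 * F (vcons t y)).
      by apply: continuous_mulf => //; exact: cst_continuous.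
    rewrite cintZ; last exact: continuous_addf.
    by rewrite cintD // cintZ // mulN1r [h *: 1]mulr1.
  apply: cint_spec_dist => //; first exact: cintP.
    apply: continuous_mulf; first exact: cst_continuous.
    apply: continuous_addf => //.
    by apply: continuous_mulf => //; exact: cst_continuous.
  by move=> y cy; rewrite mulN1r; exact: key.
rewrite (_ : (fun t => _) = fun=> 0) ?int1_cst ?mulr0 //.
apply/funext => t; rewrite (_ : (fun y => _) = pd i (fun z => F (vcons t z))); last first.
  by apply/funext => y; rewrite vcons_pdS.
apply: IH.
- exact: continuous_vconsr.
- by move=> y; apply: vcons_derivableS.
- have := @continuous_vconsr _ _ t cdF.
  by under eq_fun do rewrite vcons_pdS.
- by move=> x x1; apply: F0; rewrite vconsS.
Qed.

End CubeIntegral.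

(** * Partial derivatives and functions of class C^k *)

Section Pd.
Variables (R : realType) (n : nat).
Local Notation pt := 'rV[R]_n.
Implicit Types (f g : pt -> R) (x : pt) (i : 'I_n).

Lemma pd_near_eq i f g x : (\near x, f x = g x) -> pd i f x = pd i g x.
Proof. exact: near_eq_derive. Qed.

Lemma near_eq_continuous f g x : (\near x, f x = g x) ->
  {for x, continuous f} -> {for x, continuous g}.
Proof.
move=> fg cf; have e := nbhs_singleton fg.
have h : f @ x --> f x by exact: cf.
rewrite /prop_for /continuous_at -e => A /h.
by apply: filterS2 fg => y /= ->.
Qed.

Lemma pdD i f g x : derivable f x (ej R i) -> derivable g x (ej R i) ->
  pd i (fun y => f y + g y) x = pd i f x + pd i g x.
Proof. exact: deriveD. Qed.

Lemma pdM i f g x : derivable f x (ej R i) -> derivable g x (ej R i) ->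
  pd i (fun y => f y * g y) x = pd i f x * g x + f x * pd i g x.
Proof.
by move=> df dg; rewrite [LHS](deriveM df dg) addrC; congr (_ + _); exact: mulrC.
Qed.

Lemma derivable_cstf i (k : R) x : derivable (fun=> k : R) x (ej R i).
Proof. exact: derivable_cst. Qed.

Lemma derivable_addf i f g x : derivable f x (ej R i) -> derivable g x (ej R i) ->
  derivable (fun y => f y + g y) x (ej R i).
Proof. exact: derivableD. Qed.

Lemma derivable_mulf i f g x : derivable f x (ej R i) -> derivable g x (ej R i) ->
  derivable (fun y => f y * g y) x (ej R i).
Proof. exact: derivableM. Qed.

Lemma pd_cst i (k : R) x : pd i (fun=> k) x = 0.
Proof. exact: derive_cst. Qed.

Lemma pdZ i (k : R) f x : derivable f x (ej R i) ->
  pd i (fun y => k * f y) x = k * pd i f x.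
Proof. by move=> df; rewrite (pdM (@derivable_cstf i k x) df) pd_cst mul0r add0r. Qed.

Lemma pdV i f x : f x != 0 -> derivable f x (ej R i) ->
  pd i (fun y => (f y)^-1) x = - (f x) ^- 2 * pd i f x.
Proof. by move=> f0 df; exact: (deriveV f0 df). Qed.

Lemma is_derive_coord i j x :
  is_derive x (ej R i) (fun y : pt => y 0 j) (j == i)%:R.
Proof.
have E h : h != 0 -> h^-1 *: (((fun y : pt => y 0 j) \o shift x) (h *: ej R i) - x 0 j) = (j == i)%:R.
  by move=> h0; rewrite /= shift_ej addrK [LHS]mulrA mulVf // mul1r.
have cvg : h^-1 *: (((fun y : pt => y 0 j) \o shift x) (h *: ej R i) - x 0 j) @[h --> 0^'] --> ((j == i)%:R : R).
  apply: cvg_near_cst; near do rewrite E //.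
  exact: nbhs_dnbhs_neq.
by apply: DeriveDef; [apply/cvg_ex; exists (j == i)%:R|exact/cvg_lim].
Unshelve. all: by end_near. Qed.

Lemma pd_coord i j x : pd i (fun y : pt => y 0 j) x = (j == i)%:R.
Proof. by have [_ e] := is_derive_coord i j x; exact: e. Qed.

Lemma is_derive_comp1 (phi : R -> R) (dphi : R) f x i :
  derivable f x (ej R i) -> is_derive (f x) 1 phi dphi ->
  is_derive x (ej R i) (fun y => phi (f y)) (dphi * pd i f x).
Proof.
move=> df dP; pose F := fun h : R => f (h *: ej R i + x).
have F0 : F 0 = f x by rewrite /F scale0r add0r.
have shiftE (g : pt -> R) (a : R) : is_derive (0 : R) 1 (fun h : R => g (h *: ej R i + x)) a ->
    is_derive x (ej R i) g a.
  move=> [d1 d2]; apply: DeriveDef; first exact/derivable1P.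
  rewrite -d2 /derive; congr (lim (_ @ 0^')); apply/funext => h /=.
  by rewrite addr0 scale0r add0r [h *: 1]mulr1.
have dF : is_derive (0 : R) 1 F (pd i f x).
  move/derivable1P : (df) => dF; apply: DeriveDef => //.
  rewrite /pd /derive; congr (lim (_ @ 0^')); apply/funext => h /=.
  by rewrite /F addr0 scale0r add0r [h *: 1]mulr1.
apply: shiftE; apply: (@is_derive1_comp _ phi F) => //.
by rewrite F0.
Qed.

End Pd.

Section Ck.
Variables (R : realType) (n : nat) (U : set 'rV[R]_n).
Hypothesis oU : open U.
Local Notation pt := 'rV[R]_n.
Implicit Types (f g : pt -> R) (x : pt) (i : 'I_n).

(** Continuous iterated partial derivatives are all that coordinatewise integration by parts
    consumes, and the notion also fits powers of the cutoff, for which only C^1 regularity is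
    established. *)
Fixpoint Ck k f : Prop :=
  (forall x, U x -> {for x, continuous f}) /\
  match k with
  | 0 => True
  | k'.+1 => forall i, (forall x, U x -> derivable f x (ej R i)) /\ Ck k' (pd i f)
  end.

Lemma Ck0I f : (forall x, U x -> {for x, continuous f}) -> Ck 0 f.
Proof. by []. Qed.

Lemma CkSI k f : (forall x, U x -> {for x, continuous f}) ->
  (forall x i, U x -> derivable f x (ej R i)) -> (forall i, Ck k (pd i f)) ->
  Ck k.+1 f.
Proof. by move=> cf df Cf; split => // i; split => // x; exact: df. Qed.

Lemma Ck_continuous k f x : Ck k f -> U x -> {for x, continuous f}.
Proof. by case: k => [|k] [cf _]; exact: cf. Qed.

Lemma Ck_derivable k f x i : Ck k.+1 f -> U x -> derivable f x (ej R i).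
Proof. by move=> [_ df]; have [+ _] := df i; exact. Qed.

Lemma Ck_pd k f i : Ck k.+1 f -> Ck k (pd i f).
Proof. by move=> [_ df]; have [] := df i. Qed.

Lemma Ck_pred k f : Ck k.+1 f -> Ck k f.
Proof.
elim: k f => [|k IH] f [cf df]; split => // i.
by have [di /IH] := df i.
Qed.

Lemma Ck_le m k f : (m <= k)%N -> Ck k f -> Ck m f.
Proof.
move=> /subnK <-; elim: (k - m)%N => [//|d IH]; rewrite addSn.
by move/Ck_pred.
Qed.

Lemma Ck_near f g x : {in U, f =1 g} -> U x -> \near x, f x = g x.
Proof.
move=> fg Ux; have := open_nbhs_nbhs (conj oU Ux).
by apply: filterS => y Uy; apply: fg; rewrite inE.
Qed.

Lemma Ck_eq k f g : {in U, f =1 g} -> Ck k f -> Ck k g.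
Proof.
elim: k f g => [|k IH] f g fg [cf df]; have nfg y (Uy : U y) : \near y, f y = g y by exact: Ck_near.
  by split => // x Ux; apply: near_eq_continuous (cf x Ux); exact: nfg.
split.
  by move=> x Ux; apply: near_eq_continuous (cf x Ux); exact: nfg.
move=> i; have [di ci] := df i; split.
  by move=> x Ux; apply: near_eq_derivable (di x Ux); exact: nfg.
apply: IH ci => x /set_mem Ux; apply: pd_near_eq; exact: nfg.
Qed.

Lemma Ck_cst k (c : R) : Ck k (fun=> c).
Proof.
elim: k c => [|k IH] c; split => //; try by move=> x _; exact: cst_continuous.
move=> i; split; first by move=> x _; exact: derivable_cst.
by apply: Ck_eq (IH 0) => x _; rewrite pd_cst.
Qed.

Lemma Ck_coord k j : Ck k (fun x => x 0 j).
Proof.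
have c x : U x -> {for x, continuous (fun x : pt => x 0 j)} by move=> _; exact: coord_continuous.
case: k => [|k]; split => // i; split.
  by move=> x _; case: (is_derive_coord i j x).
by apply: Ck_eq (Ck_cst k (j == i)%:R) => x _; rewrite pd_coord.
Qed.

Lemma Ck_add k f g : Ck k f -> Ck k g -> Ck k (fun x => f x + g x).
Proof.
elim: k f g => [|k IH] f g Cf Cg; split => //;
  try by move=> x Ux; apply: continuousD; [exact: Ck_continuous Cf Ux|exact: Ck_continuous Cg Ux].
move=> i; have df x (Ux : U x) := @Ck_derivable _ _ x i Cf Ux.
have dg x (Ux : U x) := @Ck_derivable _ _ x i Cg Ux; split.
  by move=> x Ux; apply: derivableD; [exact: df|exact: dg].
apply: (@Ck_eq _ (fun x => pd i f x + pd i g x)).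
  by move=> x /set_mem Ux; rewrite pdD //; [exact: df|exact: dg].
by apply: IH; apply: Ck_pd.
Qed.

Lemma Ck_mul k f g : Ck k f -> Ck k g -> Ck k (fun x => f x * g x).
Proof.
elim: k f g => [|k IH] f g Cf Cg; split => //;
  try by move=> x Ux; apply: continuousM; [exact: Ck_continuous Cf Ux|exact: Ck_continuous Cg Ux].
move=> i; have df x (Ux : U x) := @Ck_derivable _ _ x i Cf Ux.
have dg x (Ux : U x) := @Ck_derivable _ _ x i Cg Ux; split.
  by move=> x Ux; apply: derivableM; [exact: df|exact: dg].
apply: (@Ck_eq _ (fun x => pd i f x * g x + f x * pd i g x)).
  by move=> x /set_mem Ux; rewrite pdM //; [exact: df|exact: dg].
by apply: Ck_add; apply: IH; (exact: Ck_pd || exact: Ck_pred).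
Qed.

Lemma Ck_exp k f m : Ck k f -> Ck k (fun x => f x ^+ m).
Proof.
move=> Cf; elim: m => [|m IH]; first by apply: Ck_eq (Ck_cst k 1) => x _; rewrite expr0.
by apply: Ck_eq (Ck_mul Cf IH) => x _; rewrite exprS.
Qed.

Lemma Ck_sum k (I : Type) (r : seq I) (P : pred I) (f : I -> pt -> R) :
  (forall j, Ck k (f j)) -> Ck k (fun x => \sum_(j <- r | P j) f j x).
Proof.
move=> Cf; elim: r => [|j r IH].
  by apply: Ck_eq (Ck_cst k 0) => x _; rewrite big_nil.
under eq_fun do rewrite big_cons.
by case: (P j) => //; exact: Ck_add.
Qed.

Lemma Ck_inv k f : (forall x, U x -> f x != 0) -> Ck k f -> Ck k (fun x => (f x)^-1).
Proof.
move=> f0; elim: k f f0 => [|k IH] f f0 Cf; split => //;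
  try by move=> x Ux; apply: continuousV; [exact: f0|exact: Ck_continuous Cf Ux].
move=> i; have df x (Ux : U x) := @Ck_derivable _ _ x i Cf Ux; split.
  by move=> x Ux; apply: derivableV; [exact: f0|exact: df].
apply: (@Ck_eq _ (fun x => -1 * (pd i f x * ((f x)^-1 * (f x)^-1)))).
  move=> x /set_mem Ux; rewrite /pd [RHS]deriveV; [|exact: f0|exact: df].
  rewrite mulN1r mulrC [RHS]mulNr; congr (- (_ * _)).
  by rewrite -exprVn expr2.
apply: Ck_mul; first exact: Ck_cst.
have Cp := Ck_pred Cf.
by apply: Ck_mul; [exact: Ck_pd|apply: Ck_mul; exact: IH].
Qed.

Lemma smooth_on_Ck k f : smooth_on U f -> Ck k f.
Proof.
move=> sf; suff : forall l, Ck k (foldr (@pd R n) f l) by move=> /(_ [::]).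
elim: k => [|k IH] l; split => //;
  try by move=> x Ux; apply: differentiable_continuous; exact: sf.
move=> i; split; first by move=> x Ux; apply: diff_derivable; exact: sf.
exact: (IH (i :: l)).
Qed.

End Ck.

(* Unfolding [Ck] during failed unifications is prohibitively slow. *)
Global Opaque Ck.

(** * Cutoff functions on the ball *)

Section PosPart.
Variable R : realType.

Definition pos_part (y : R) : R := Num.max 0 y.

Lemma pos_part_ge0 y : 0 <= pos_part y.
Proof. by rewrite /pos_part le_max lexx. Qed.

Lemma pos_part_id y : 0 <= y -> pos_part y = y.
Proof. by move=> y0; apply/max_idPr. Qed.

Lemma pos_part_eq0 y : y <= 0 -> pos_part y = 0.
Proof. by move=> y0; apply/max_idPl. Qed.

Lemma pos_part_continuous : continuous pos_part.
Proof.
have -> : pos_part = fun y => 2^-1 * (y + `|y|).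
  apply/funext => y; have [y0|y0] := leP 0 y.
    by rewrite pos_part_id // ger0_norm //; field.
  by rewrite pos_part_eq0 ?ltW // ltr0_norm // subrr mulr0.
apply: continuous_mulf; first exact: cst_continuous.
by apply: continuous_addf => y; [exact: cvg_id|exact: norm_continuous].
Qed.

(** At the kink the difference quotient is at most [|h| ^+ m.+1], which tends to [0]. The exponent
    starts at two so that the derivative is continuous as well. *)
Lemma is_derive_pos_partX m (y : R) :
  is_derive y 1 (fun y => pos_part y ^+ m.+2) (m.+2%:R * pos_part y ^+ m.+1).
Proof.
have [y0|y0|->] := ltrgt0P y.
- apply: (@near_eq_is_derive R R R (fun y : R => y ^+ m.+2)).
    near=> z; rewrite pos_part_id //; apply: ltW; near: z; exact: lt_nbhsr.
  rewrite pos_part_id ?ltW //.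
  have -> : m.+2%:R * y ^+ m.+1 = (m.+2%:R * y ^+ m.+1) *: (1 : R) by rewrite [RHS]mulr1.
  have H := @is_deriveX R _ id m.+2 y 1 1 (is_derive_id _ _). by rewrite exprfctE in H.
- apply: (@near_eq_is_derive R R R (fun=> 0)).
    near=> z; rewrite pos_part_eq0 ?expr0n //; apply: ltW; near: z; exact: lt_nbhsl.
  by rewrite pos_part_eq0 ?ltW // expr0n mulr0; exact: is_derive_cst.
- rewrite pos_part_eq0 // expr0n mulr0.
  have cvg : h^-1 *: (((fun y => pos_part y ^+ m.+2) \o shift 0) (h *: 1) - pos_part 0 ^+ m.+2) @[h --> 0^'] --> (0 : R).
    apply/cvgrPdist_le => e e0; near=> h.
    have h1 : `|h| <= 1.
      by near: h; exact: dnbhs0_le.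
    have he : `|h| <= e.
      by near: h; exact: dnbhs0_le.
    have h0 : h != 0 by near: h; exact: nbhs_dnbhs_neq.
    rewrite /= addr0 [h *: 1]mulr1 (pos_part_eq0 (lexx (0 : R))) expr0n subr0 sub0r normrN normrM normfV.
    rewrite normrX ger0_norm ?pos_part_ge0 // (le_trans _ he) // ler_pdivrMl ?normr_gt0 //.
    have ph : pos_part h <= `|h| by rewrite /pos_part ge_max normr_ge0 ler_norm.
    rewrite -expr2 (le_trans (_ : _ <= `|h| ^+ m.+2)) ?lerXn2r ?nnegrE ?pos_part_ge0 //.
    by rewrite -addn2 exprD ler_piMl ?exprn_ge0 // exprn_ile1.
  by apply: DeriveDef; [apply/cvg_ex; exists 0|exact/cvg_lim].
Unshelve. all: by end_near. Qed.

End PosPart.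

(** * The Poincare ball and its divergence theorem *)

Section Ball.
Variables (R : realType) (n : nat).
Local Notation pt := 'rV[R]_n.
Local Notation ball := (@ball_model R n).
Local Notation s := (@sqnorm R n).
Implicit Types x : pt.

Lemma sqnorm_ge0 x : 0 <= s x.
Proof. by apply: sumr_ge0 => i _; exact: sqr_ge0. Qed.

Lemma coord_le_sqnorm x i : x 0 i ^+ 2 <= s x.
Proof.
rewrite /sqnorm (bigD1 i) //= lerDl.
by apply: sumr_ge0 => j _; exact: sqr_ge0.
Qed.

Lemma Ck_sqnorm U k : open U -> Ck U k s.
Proof. by move=> oU; apply: Ck_sum => // i; apply: Ck_exp => //; exact: Ck_coord. Qed.

Lemma pd_sqnorm i x : pd i s x = 2 * x 0 i.
Proof.
have d j : is_derive x (ej R i) (fun y : pt => y 0 j ^+ 2) (2 * x 0 j * (j == i)%:R).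
  have -> : 2 * x 0 j * (j == i)%:R = (2 * x 0 j ^+ 1) *: ((j == i)%:R : R) by [].
  have H := @is_deriveX R _ _ 2 _ _ _ (is_derive_coord i j x).
  by rewrite exprfctE in H.
have := @is_derive_sum _ _ _ n (fun j (y : pt) => y 0 j ^+ 2) x (ej R i) _ d.
move=> /(@derive_val _ _ _ _ _ _ _) H.
rewrite /pd (_ : s = \sum_(j < n) (fun y : pt => y 0 j ^+ 2)); last first.
  by apply/funext => y; rewrite fct_sumE.
rewrite H (bigD1 i) //= eqxx mulr1 big1 ?addr0 // => j /negPf ->.
by rewrite mulr0.
Qed.

Lemma sqnorm_continuous : continuous s.
Proof. by move=> x; apply: (Ck_continuous (Ck_sqnorm 0 openT)). Qed.

Lemma open_ball_model : open ball.
Proof.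
have -> : ball = s @^-1` [set t | t < 1] by [].
by apply: open_comp; [move=> x _; exact: sqnorm_continuous|exact: open_lt].
Qed.

Lemma ball_gt0 x : ball x -> 0 < 1 - s x.
Proof. by rewrite /ball_model /= subr_gt0. Qed.

Lemma ball_neq0 x : ball x -> 1 - s x != 0.
Proof. by move=> /ball_gt0 /gt_eqF ->. Qed.

Lemma Ck_1sub k : Ck ball k (fun x => 1 - s x).
Proof.
have o := open_ball_model.
apply: (@Ck_eq _ _ _ _ _ (fun x => 1 + -1 * s x)) => // [x _|]; first by rewrite mulN1r.
by apply: Ck_add => //; [exact: Ck_cst|apply: Ck_mul => //; [exact: Ck_cst|exact: Ck_sqnorm]].
Qed.

Lemma pd_1sub i x : pd i (fun x => 1 - s x) x = - 2 * x 0 i.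
Proof.
have d : derivable s x (ej R i) by apply: (@Ck_derivable _ _ setT 0) => //; exact: Ck_sqnorm openT.
rewrite (_ : (fun x => _) = fun x => 1 + -1 * s x); last by apply/funext => y; rewrite mulN1r.
rewrite (pdD (@derivable_cstf _ _ i 1 x) (derivable_mulf (@derivable_cstf _ _ i (-1) x) d)).
by rewrite pd_cst (pdZ _ d) pd_sqnorm; ring.
Qed.

Lemma near_out (rho : R) x : rho < s x -> \near x, rho < s x.
Proof.
move=> rx; have o : open (s @^-1` [set t | rho < t]).
  by apply: open_comp; [move=> y _; exact: sqnorm_continuous|exact: open_gt].
exact: (open_nbhs_nbhs (conj o rx)).
Qed.

(** A point with [s x < 1] lies in the open ball; any other lies in the open set [rho < s x], where
    [f] is locally zero. The partial derivatives vanish on the same open set, so the induction goes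
    on with the same [rho]. *)
Lemma Ck_extend k (f : pt -> R) (rho : R) : rho < 1 -> Ck ball k f ->
  (forall x, rho < s x -> f x = 0) -> Ck setT k f.
Proof.
move=> r1 Cf f0.
elim: k f Cf f0 => [|k IH] f Cf f0.
  apply: Ck0I => x _; have [bx|bx] := ltP (s x) 1; first exact: Ck_continuous Cf bx.
  apply: (@near_eq_continuous _ _ (fun=> 0)); last exact: cst_continuous.
  by near=> y; rewrite f0 //; near: y; apply: near_out; exact: lt_le_trans bx.
apply: CkSI => [x _|x i _|i].
- have [bx|bx] := ltP (s x) 1; first exact: Ck_continuous Cf bx.
  apply: (@near_eq_continuous _ _ (fun=> 0)); last exact: cst_continuous.
  by near=> y; rewrite f0 //; near: y; apply: near_out; exact: lt_le_trans bx.
- have [bx|bx] := ltP (s x) 1; first exact: Ck_derivable Cf bx.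
  apply: (@near_eq_derivable _ _ _ (fun=> 0)); last exact: derivable_cst.
  by near=> y; rewrite f0 //; near: y; apply: near_out; exact: lt_le_trans bx.
apply: IH; first exact: Ck_pd.
move=> x rx; rewrite -(pd_cst i 0 x); apply: pd_near_eq.
by near=> y; rewrite f0 //; near: y; apply: near_out.
Unshelve. all: by end_near. Qed.

Lemma ball_divergence (F : 'I_n -> pt -> R) (rho : R) : rho < 1 ->
  (forall i, Ck ball 1 (F i)) -> (forall i x, rho < s x -> F i x = 0) ->
  cint (fun x => \sum_(i < n) pd i (F i) x) = 0.
Proof.
move=> r1 CF F0.
have CT i := Ck_extend r1 (CF i) (F0 i).
have c1 i : continuous (pd i (F i)).
  by move=> x; apply: (Ck_continuous (Ck_pd i (CT i))).
have z i : cint (pd i (F i)) = 0.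
  apply: cint_pd => //.
  - by move=> x; apply: (Ck_continuous (CT i)).
  - by move=> x; apply: (Ck_derivable (CT i)).
  (* A point on a face of the cube has [1 <= s x], hence lies beyond [rho]. *)
  - move=> x x1; apply: F0; apply: lt_le_trans r1 _.
    by apply: le_trans (coord_le_sqnorm x i); case: x1 => ->; rewrite ?sqrrN expr1n.
elim: (index_enum _) => [|i r IH].
  by under eq_fun do rewrite big_nil; rewrite cint_cst mulr0.
under eq_fun do rewrite big_cons.
by rewrite cintD ?z ?IH ?addr0 //; exact: continuous_sumf.
Qed.

End Ball.

(** * Logarithmic cutoffs and the vanishing criterion *)

Section Cutoff.
Variables (R : realType) (n : nat).
Local Notation pt := 'rV[R]_n.
Local Notation ball := (@ball_model R n).
Local Notation s := (@sqnorm R n).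
Implicit Types (x : pt) (e : R).

(* Logarithmic in [1 - |x|^2], so that the hyperbolic norm of its gradient is at
   most [e], uniformly on the ball, while it tends to [1] as [e] tends to [0].
   The guard is needed because [ln] is [0] on negative numbers. *)
Definition cutoff e x : R := if s x < 1 then pos_part (1 + e * ln (1 - s x)) else 0.

Lemma cutoffE e x : ball x -> cutoff e x = pos_part (1 + e * ln (1 - s x)).
Proof. by rewrite /cutoff /ball_model /= => ->. Qed.

Lemma cutoff_ge0 e x : 0 <= cutoff e x.
Proof. by rewrite /cutoff; case: ifP => // _; exact: pos_part_ge0. Qed.

Lemma ln_1sub_le0 x : ln (1 - s x) <= 0.
Proof. by apply: ln_le0; rewrite gerBl sqnorm_ge0. Qed.

Lemma cutoff_le1 e x : 0 <= e -> cutoff e x <= 1.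
Proof.
move=> e0; rewrite /cutoff; case: ifP => // _; rewrite /pos_part ge_max ler01 /=.
by rewrite gerDl mulr_ge0_le0 // ln_1sub_le0.
Qed.

Lemma cutoff_anti e e' x : e <= e' -> cutoff e' x <= cutoff e x.
Proof.
move=> ee'; rewrite /cutoff; case: ifP => // _.
rewrite /pos_part ge_max !le_max lexx /= lerD2l; apply/orP; right.
by rewrite ler_wnM2r // ln_1sub_le0.
Qed.

(** [expR (- e^-1)] is the value of [1 - s x] at which [1 + e * ln (1 - s x)] reaches zero. *)
Lemma cutoff_out e x : 0 < e -> 1 - expR (- e^-1) < s x -> cutoff e x = 0.
Proof.
move=> e0 sx; rewrite /cutoff; case: ifP => // s1.
apply: pos_part_eq0; have u0 : 0 < 1 - s x by rewrite subr_gt0.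
have : ln (1 - s x) <= - e^-1.
  by rewrite -[leRHS]expRK ler_ln ?posrE ?expR_gt0 //; lra.
by move=> /(ler_wpM2l (ltW e0)); rewrite mulrN mulfV ?gt_eqF //; lra.
Qed.

Lemma cutoff_gt0 x : ball x -> exists2 e, 0 < e <= 1 & 0 < cutoff e x.
Proof.
move=> bx; have l0 := ln_1sub_le0 x.
have d0 : 0 < 1 - ln (1 - s x) by lra.
(* For this [e] the expression [1 + e * ln (1 - s x)] equals [e] itself. *)
exists (1 - ln (1 - s x))^-1.
  by rewrite invr_gt0 d0 /= invf_le1 //; lra.
have E : 1 + (1 - ln (1 - s x))^-1 * ln (1 - s x) = (1 - ln (1 - s x))^-1.
  by field; rewrite gt_eqF.
by rewrite cutoffE // E pos_part_id ?invr_gt0 // ltW // invr_gt0.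
Qed.

Lemma is_derive_ln1sub i x : ball x ->
  is_derive x (ej R i) (fun y => ln (1 - s y)) ((1 - s x)^-1 * (- 2 * x 0 i)).
Proof.
move=> bx; rewrite -pd_1sub; apply: (@is_derive_comp1 _ _ (@ln R)).
  by apply: (@Ck_derivable _ _ ball 0) => //; exact: Ck_1sub.
exact/is_derive1_ln/ball_gt0.
Qed.

Lemma is_derive_cutoffX e m i x : ball x ->
  is_derive x (ej R i) (fun y => cutoff e y ^+ m.+2)
    (m.+2%:R * cutoff e x ^+ m.+1 * (e * ((1 - s x)^-1 * (- 2 * x 0 i)))).
Proof.
move=> bx; have o := @open_ball_model R n.
apply: (@near_eq_is_derive R _ R (fun y => pos_part (1 + e * ln (1 - s y)) ^+ m.+2)).
  by near=> y; rewrite cutoffE //; near: y; exact: (open_nbhs_nbhs (conj o bx)).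
have [d1 d2] := is_derive_ln1sub i bx.
have d3 := derivable_mulf (@derivable_cstf _ _ i e x) d1.
have d4 := derivable_addf (@derivable_cstf _ _ i 1 x) d3.
have -> : e * ((1 - s x)^-1 * (- 2 * x 0 i)) = pd i (fun y => 1 + e * ln (1 - s y)) x.
  rewrite (pdD (@derivable_cstf _ _ i 1 x) d3) pd_cst add0r (pdZ _ d1).
  by congr (_ * _); rewrite -d2.
rewrite (cutoffE _ bx).
exact: (is_derive_comp1 d4 (is_derive_pos_partX m _)).
Unshelve. all: by end_near. Qed.

Lemma pd_cutoffX e m i x : ball x ->
  pd i (fun y => cutoff e y ^+ m.+2) x =
  m.+2%:R * cutoff e x ^+ m.+1 * (e * ((1 - s x)^-1 * (- 2 * x 0 i))).
Proof. by move=> bx; have [_ H] := is_derive_cutoffX e m i bx; exact: H. Qed.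

Lemma Ck_cutoff e : Ck ball 0 (cutoff e).
Proof.
apply: Ck0I => x bx; have o := @open_ball_model R n.
apply: (@near_eq_continuous _ _ (fun y => pos_part (1 + e * ln (1 - s y)))).
  by near=> y; rewrite cutoffE //; near: y; exact: (open_nbhs_nbhs (conj o bx)).
apply: (@continuous_comp _ _ _ (fun y => 1 + e * ln (1 - s y))); last exact: pos_part_continuous.
apply: continuousD; first exact: cst_continuous.
apply: continuousM; first exact: cst_continuous.
apply: (@continuous_comp _ _ _ (fun y => 1 - s y)).
  exact: (Ck_continuous (@Ck_1sub R n 0) bx).
exact/continuous_ln/ball_gt0.
Unshelve. all: by end_near. Qed.

Lemma Ck1_cutoffX e m : Ck ball 1 (fun x => cutoff e x ^+ m.+2).
Proof.
have o := @open_ball_model R n; have C0 := Ck_exp o.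
apply: CkSI => [x bx|x i bx|i].
- exact: Ck_continuous (C0 _ _ m.+2 (Ck_cutoff e)) bx.
- by case: (is_derive_cutoffX e m i bx).
apply: (@Ck_eq _ _ _ o 0 (fun x => m.+2%:R * cutoff e x ^+ m.+1 *
    (e * ((1 - s x)^-1 * (- 2 * x 0 i))))).
  by move=> x /set_mem bx; rewrite pd_cutoffX.
apply: (Ck_mul o (Ck_mul o (Ck_cst o _ _) (C0 _ _ _ (Ck_cutoff e)))).
apply: (Ck_mul o (Ck_cst o _ _) (Ck_mul o _ (Ck_mul o (Ck_cst o _ _) (Ck_coord o _ _)))).
by apply: Ck_inv => //; [exact: ball_neq0|exact: Ck_1sub].
Qed.

Lemma expR_rho e : 1 - expR (- e^-1) < 1.
Proof. by rewrite gtrBl expR_gt0. Qed.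

(** The exponent is at least one because [f] is unconstrained outside the ball: a factor [cutoff]
    replaces it there by zero. *)
Lemma cutoff_continuous e m (f : pt -> R) : 0 < e -> Ck ball 0 f ->
  continuous (fun x => cutoff e x ^+ m.+1 * f x).
Proof.
move=> e0 Cf x; have o := @open_ball_model R n.
have C : Ck ball 0 (fun x => cutoff e x ^+ m.+1 * f x).
  by apply: Ck_mul => //; apply: Ck_exp => //; exact: Ck_cutoff.
apply: (Ck_continuous (Ck_extend (expR_rho e) C _)) => // y ys.
by rewrite cutoff_out // exprS !mul0r.
Qed.

Lemma cutoff_divergence e m (F : 'I_n -> pt -> R) : 0 < e ->
  (forall i, Ck ball 1 (F i)) ->
  cint (fun x => \sum_(i < n) pd i (fun y => cutoff e y ^+ m.+2 * F i y) x) = 0.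
Proof.
move=> e0 CF; have o := @open_ball_model R n.
apply: ball_divergence (expR_rho e) _ _ => [i|i x sx].
  by apply: Ck_mul => //; exact: Ck1_cutoffX.
by rewrite cutoff_out // exprS !mul0r.
Qed.

Lemma cutoff_flux_continuous e m (F : 'I_n -> pt -> R) : 0 < e ->
  (forall i, Ck ball 1 (F i)) ->
  continuous (fun x => \sum_(i < n) pd i (fun y => cutoff e y ^+ m.+2 * F i y) x).
Proof.
move=> e0 CF; have o := @open_ball_model R n.
apply: continuous_sumf => i _ x.
apply: (Ck_continuous (Ck_pd i (Ck_extend (expR_rho e) _ _))) => //.
  by apply: Ck_mul => //; exact: Ck1_cutoffX.
by move=> y sx; rewrite cutoff_out // exprS !mul0r.
Qed.

Lemma cutoff_flux_out e m (F : 'I_n -> pt -> R) x : 0 < e -> ~~ (s x < 1) ->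
  \sum_(i < n) pd i (fun y => cutoff e y ^+ m.+1 * F i y) x = 0.
Proof.
move=> e0 bx; rewrite big1 // => i _.
rewrite -(pd_cst i 0 x); apply: pd_near_eq.
have sx : 1 - expR (- e^-1) < s x.
  by apply: lt_le_trans (expR_rho e) _; rewrite leNgt.
near=> y; rewrite cutoff_out ?exprS ?mul0r //.
by near: y; exact: near_out.
Unshelve. all: by end_near. Qed.

(** No limit is taken under the integral sign. By [cutoff_anti] the integral at [e] is at most the
    integral at any smaller [d], hence at most [C * d]. So it is zero for each fixed [e], and [G]
    vanishes wherever that cutoff is positive; such sets cover the ball. *)
Lemma cutoff_vanish m (G : pt -> R) (C : R) : Ck ball 0 G ->
  (forall x, ball x -> 0 <= G x) ->
  (forall e, 0 < e <= 1 -> cint (fun x => cutoff e x ^+ m.+1 * G x) <= C * e) ->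
  forall x, ball x -> G x = 0.
Proof.
move=> CG G0 bound x bx.
have [e /andP[e0 e1] cx] := cutoff_gt0 bx.
have pos d y : 0 <= cutoff d y ^+ m.+1 * G y.
  have [by_|by_] := ltP (s y) 1.
    by rewrite mulr_ge0 ?exprn_ge0 ?cutoff_ge0 // G0.
  by rewrite /cutoff ltNge by_ /= exprS !mul0r.
have cont d (d0 : 0 < d) := @cutoff_continuous d m G d0 CG.
have I0 : cint (fun x => cutoff e x ^+ m.+1 * G x) = 0.
  apply/eqP; rewrite eq_le cint_ge0 ?andbT //; last exact: cont.
  have bnd d : 0 < d <= e -> cint (fun x => cutoff e x ^+ m.+1 * G x) <= C * d.
    move=> /andP[d0 de]; apply: le_trans (bound d _); last by rewrite d0 (le_trans de).
    apply: cint_le; [exact: cont|exact: cont|move=> y _].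
    have [by_|by_] := ltP (s y) 1; last by rewrite /cutoff ltNge by_ /= exprS !mul0r.
    rewrite ler_wpM2r ?G0 // lerXn2r ?nnegrE ?cutoff_ge0 //.
    exact: cutoff_anti.
  rewrite leNgt; apply/negP => I0.
  set I := cint _ in bnd I0 *.
  have C0 : 0 < C by have := bnd e; rewrite e0 lexx => /(_ isT) h; rewrite -(pmulr_lgt0 _ e0); lra.
  (* At this parameter [C * d] is at most half of the integral [I] supposed positive. *)
  have d0 : 0 < Num.min e (I / (2 * C)) by rewrite lt_min e0 divr_gt0 ?mulr_gt0.
  have := bnd (Num.min e (I / (2 * C))); rewrite d0 ge_min lexx => /(_ isT).
  have : C * Num.min e (I / (2 * C)) <= I / 2.
    apply: (@le_trans _ _ (C * (I / (2 * C)))); first by rewrite ler_wpM2l ?ge_min ?lexx ?orbT // ltW.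
    by rewrite le_eqVlt; apply/orP; left; apply/eqP; field; rewrite gt_eqF.
  by lra.
have xI i : -1 < x 0 i < 1.
  rewrite -ltr_norml -(@expr_lt1 _ 2) // real_normK ?num_real //.
  exact: le_lt_trans (coord_le_sqnorm x i) bx.
have /eqP := cint_eq0 (cont e e0) (fun y _ => pos e y) I0 xI.
by rewrite mulf_eq0 expf_eq0 /= (gt_eqF cx) /= => /eqP.
Qed.

End Cutoff.

(** * L2 forms with coclosed differential are closed *)

Section Energy.
Variables (R : realType) (n : nat).
Local Notation pt := 'rV[R]_n.
Local Notation ball := (@ball_model R n).
Local Notation s := (@sqnorm R n).
Implicit Types x : pt.

Definition form_sq (a : 'I_n -> pt -> R) x : R := \sum_(j < n) a j x ^+ 2.
Definition curl (a : 'I_n -> pt -> R) i j x : R := pd i (a j) x - pd j (a i) x.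
Definition curl_sq (a : 'I_n -> pt -> R) x : R :=
  \sum_(i < n) \sum_(j < n) curl a i j x ^+ 2.
(* If [w] is the weight of [|a|^2] in the energy of a 1-form, then this is the
   weight of [|da|^2]: raising one more index costs [((1 - |x|^2) / 2)^2]. *)
Definition weight2 (w : pt -> R) x : R := w x * ((1 - s x) / 2) ^+ 2.

Lemma form_sq_ge0 a x : 0 <= form_sq a x.
Proof. by apply: sumr_ge0 => j _; exact: sqr_ge0. Qed.

Lemma curl_sq_ge0 a x : 0 <= curl_sq a x.
Proof. by apply: sumr_ge0 => i _; apply: sumr_ge0 => j _; exact: sqr_ge0. Qed.

Lemma pd_sum m i (f : 'I_m -> pt -> R) x : (forall j, derivable (f j) x (ej R i)) ->
  pd i (fun y => \sum_(j < m) f j y) x = \sum_(j < m) pd i (f j) x.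
Proof.
move=> df; have -> : (fun y => \sum_(j < m) f j y) = \sum_(j < m) f j.
  by rewrite fct_sumE.
exact: derive_sum.
Qed.

Variables (a : 'I_n -> pt -> R) (w : pt -> R) (E : R).
Hypothesis Ca : forall j, Ck ball 2 (a j).
Hypothesis Cw : Ck ball 1 w.
Hypothesis w0 : forall x, ball x -> 0 < w x.
Hypothesis energy : forall e, 0 < e ->
  cint (fun x => cutoff e x ^+ 1 * (w x * form_sq a x)) <= E.

Local Notation N := (form_sq a).
Local Notation b := (curl a).
Local Notation w' := (weight2 w).

Let o := @open_ball_model R n.

Let CN k : (k <= 2)%N -> Ck ball k N.
Proof.
by move=> k2; apply: (Ck_sum o _ _) => j; exact: (Ck_exp o 2 (Ck_le k2 (Ca j))).
Qed.

Let CwN : Ck ball 0 (fun x => w x * N x).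
Proof. exact: (Ck_mul o (Ck_pred Cw) (CN _)). Qed.

Let energy_cont e : 0 < e -> continuous (fun x => cutoff e x ^+ 1 * (w x * N x)).
Proof. by move=> e0; exact: cutoff_continuous e0 CwN. Qed.

Lemma energy_ge0 : 0 <= E.
Proof.
apply: le_trans (energy ltr01); apply: cint_ge0; first exact: energy_cont.
move=> x _; have [bx|bx] := ltP (s x) 1.
  by rewrite !mulr_ge0 ?exprn_ge0 ?cutoff_ge0 ?form_sq_ge0 // ltW // w0.
by rewrite /cutoff ltNge bx /= expr1 mul0r.
Qed.

Let Cb k i j : (k <= 1)%N -> Ck ball k (b i j).
Proof.
move=> k1; have C i' j' : Ck ball k (pd i' (a j')) := Ck_le k1 (Ck_pd i' (Ca j')).
have H := Ck_add o (C i j) (Ck_mul o (Ck_cst o k (-1)) (C j i)).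
by apply: (Ck_eq o _ H) => x _; rewrite mulN1r.
Qed.

Let Cw' k : (k <= 1)%N -> Ck ball k w'.
Proof.
move=> k1; apply: (Ck_mul o (Ck_le k1 Cw) (Ck_exp o 2 _)).
exact: (Ck_mul o (@Ck_1sub _ _ _) (Ck_cst o _ _)).
Qed.

Let w'0 x : ball x -> 0 < w' x.
Proof.
by move=> bx; rewrite mulr_gt0 ?w0 // exprn_gt0 // divr_gt0 // ball_gt0.
Qed.

Let sum_antisym x :
  \sum_(i < n) \sum_(j < n) b i j x * pd i (a j) x = 2^-1 * curl_sq a x.
Proof.
set S := LHS.
have ES : S = - \sum_(i < n) \sum_(j < n) b i j x * pd j (a i) x.
  rewrite /S exchange_big -sumrN; apply: eq_bigr => i _; rewrite -sumrN.
  by apply: eq_bigr => j _; rewrite /curl; ring.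
have : S + S = curl_sq a x.
  rewrite {2}ES -sumrB; apply: eq_bigr => i _; rewrite -sumrB.
  by apply: eq_bigr => j _; rewrite /curl; ring.
by move=> <-; field.
Qed.

(** The field whose divergence appears when [delta d a] is integrated by parts against [a]. *)
Let flux i x := \sum_(j < n) (w' x * b i j x) * a j x.

Let CwB i j : Ck ball 1 (fun x => w' x * b i j x).
Proof. exact: (Ck_mul o (@Cw' 1 isT) (@Cb 1 i j isT)). Qed.

Let Cflux i : Ck ball 1 (flux i).
Proof.
by apply: (Ck_sum o _ _) => j; exact: (Ck_mul o (CwB i j) (Ck_pred (Ca j))).
Qed.

(** By the coclosedness of the weighted [curl], only its energy and the gradient of the cutoff
    survive. The [6] is the [3] of the cube times the [2] in the gradient of [|x|^2]. *)
Lemma div_flux e x : ball x ->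
  (forall j, \sum_(i < n) pd i (fun y => w' y * b i j y) x = 0) ->
  \sum_(i < n) pd i (fun y => cutoff e y ^+ 3 * flux i y) x =
  cutoff e x ^+ 3 * w' x * (2^-1 * curl_sq a x)
  - \sum_(i < n) \sum_(j < n) 6 * (e / (1 - s x)) * cutoff e x ^+ 2 * w' x *
      (b i j x * (x 0 i * a j x)).
Proof.
move=> bx cob.
have dF i : pd i (flux i) x =
    \sum_(j < n) (pd i (fun y => w' y * b i j y) x * a j x + w' x * (b i j x * pd i (a j) x)).
  have dwb j := @Ck_derivable _ _ _ _ _ x i (CwB i j) bx.
  have da j := @Ck_derivable _ _ _ _ _ x i (Ca j) bx.
  rewrite /flux pd_sum; last by move=> j; exact: derivable_mulf (dwb j) (da j).
  by apply: eq_bigr => j _; rewrite (pdM (dwb j) (da j)) mulrA.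
have step i : pd i (fun y => cutoff e y ^+ 3 * flux i y) x =
    cutoff e x ^+ 3 * (\sum_(j < n) pd i (fun y => w' y * b i j y) x * a j x)
    + cutoff e x ^+ 3 * w' x * (\sum_(j < n) b i j x * pd i (a j) x)
    - \sum_(j < n) 6 * (e / (1 - s x)) * cutoff e x ^+ 2 * w' x *
      (b i j x * (x 0 i * a j x)).
  have [dc _] := is_derive_cutoffX e 1 i bx.
  have df := @Ck_derivable _ _ _ _ _ x i (Cflux i) bx.
  rewrite (pdM dc df) (pd_cutoffX e 1 i bx) dF big_split /= -mulr_sumr.
  set S := \sum_(j < n) 6 * _ * _ * _ * _.
  have -> : 3%:R * cutoff e x ^+ 2 * (e * ((1 - s x)^-1 * (- 2 * x 0 i))) * flux i x = - S.
    rewrite /flux /S mulr_sumr; move: (1 - s x)^-1 => u.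
    rewrite -sumrN; apply: eq_bigr => j _.
    by ring.
  by ring.
rewrite (eq_bigr _ (fun i _ => step i)) !big_split /= sumrN; congr (_ + _).
rewrite -!mulr_sumr sum_antisym exchange_big /=.
under eq_bigr do rewrite -mulr_suml cob mul0r.
by rewrite big1 // mulr0 add0r.
Qed.

Let cutoff_out1 e m x (r : R) : ~~ (s x < 1) -> cutoff e x ^+ m.+1 * r = 0.
Proof. by move=> bx; rewrite /cutoff (negPf bx) exprS !mul0r. Qed.

(** A Caccioppoli inequality. The cutoff is cubed so that, after the square is completed, one factor
    [cutoff] is left on the term in [|a|^2]; that term then extends continuously by zero to the cube
    and is controlled by the energy bound. *)
Lemma closed_of_coclosed2 :
  (forall x j, ball x -> \sum_(i < n) pd i (fun y => w' y * b i j y) x = 0) ->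
  forall x i j, ball x -> pd i (a j) x = pd j (a i) x.
Proof.
move=> cob.
have CB : Ck ball 0 (curl_sq a).
  by apply: (Ck_sum o _ _) => i; apply: (Ck_sum o _ _) => j; exact: (Ck_exp o 2 (@Cb 0 i j isT)).
have CwB0 : Ck ball 0 (fun x => w' x * curl_sq a x) := Ck_mul o (@Cw' 0 isT) CB.
have pw e x : ball x ->
    4^-1 * (cutoff e x ^+ 3 * (w' x * curl_sq a x)) <=
    \sum_(i < n) pd i (fun y => cutoff e y ^+ 3 * flux i y) x
    + 9 * e ^+ 2 * (cutoff e x ^+ 1 * (w x * N x)).
  move=> bx; rewrite (div_flux e bx (cob x ^~ bx)).
  have wE : w x = 4 * w' x / (1 - s x) ^+ 2.
    by rewrite /weight2; field; exact: ball_neq0.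
  have c0 := cutoff_ge0 e x; have ww := w'0 bx.
  (* Completing the square spends half of the available curl energy on the cross term [L]; the other
     half is the left-hand side, whence [4^-1] instead of [2^-1]. *)
  have sq : 0 <= \sum_(i < n) \sum_(j < n) cutoff e x * w' x *
     (2^-1 * cutoff e x * b i j x - 6 * (e / (1 - s x)) * (x 0 i * a j x)) ^+ 2.
    apply: sumr_ge0 => i _; apply: sumr_ge0 => j _.
    by apply: mulr_ge0 (mulr_ge0 c0 (ltW ww)) (sqr_ge0 _).
  have sN : \sum_(i < n) \sum_(j < n) (x 0 i * a j x) ^+ 2 = s x * N x.
    rewrite /sqnorm mulr_suml; apply: eq_bigr => i _; rewrite mulr_sumr.
    by apply: eq_bigr => j _; rewrite exprMn.
  set K := \sum_(i < n) _ in sq *; set L := \sum_(i < n) \sum_(j < n) 6 * _ * _ * _ * _.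
  have KE : K = 4^-1 * cutoff e x ^+ 3 * w' x * curl_sq a x - L
      + 36 * (e / (1 - s x)) ^+ 2 * cutoff e x * w' x * (s x * N x).
    rewrite -sN /K /L /curl_sq; move: (1 - s x)^-1 => u.
    rewrite !mulr_sumr -sumrB -big_split /=; apply: eq_bigr => i _.
    rewrite !mulr_sumr -sumrB -big_split /=; apply: eq_bigr => j _.
    by field.
  (* The factor [((1 - s x) / 2) ^+ 2] in [w'] cancels the singular factor of the cutoff gradient
     and gives [36 / 4 = 9]; the remaining [s x] is at most [1]. *)
  have sN1 : 36 * (e / (1 - s x)) ^+ 2 * cutoff e x * w' x * (s x * N x) <=
      9 * e ^+ 2 * (cutoff e x ^+ 1 * (w x * N x)).
    rewrite (_ : 9 * _ * _ = 36 * (e / (1 - s x)) ^+ 2 * cutoff e x * w' x * N x); last first.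
      by rewrite wE; field; exact: ball_neq0.
    rewrite ler_wpM2l ?ler_piMl ?form_sq_ge0 //; last exact: ltW.
    by apply: mulr_ge0 (mulr_ge0 (mulr_ge0 _ (sqr_ge0 _)) c0) (ltW ww).
  by move: sq; rewrite KE; lra.
have B0 : forall x, ball x -> w' x * curl_sq a x = 0.
  (* The constant is [4 * 9]; [e ^+ 2 <= e] brings the quadratic bound to the linear form that is
     required. *)
  apply: (@cutoff_vanish R n 2 (fun x => w' x * curl_sq a x) (36 * E)) => //.
    by move=> x bx; exact: mulr_ge0 (ltW (w'0 bx)) (curl_sq_ge0 _ _).
  move=> e /andP[e0 e1].
  have c1 := @cutoff_continuous R n e 2 _ e0 CwB0.
  have c2 := @cutoff_flux_continuous R n e 1 _ e0 Cflux.
  have c3 := energy_cont e0.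
  have cst (k : R) (f : pt -> R) : continuous f -> continuous (fun x => k * f x).
    by move=> cf; apply: continuous_mulf => //; exact: cst_continuous.
  have : 4^-1 * cint (fun x => cutoff e x ^+ 3 * (w' x * curl_sq a x)) <= 9 * e ^+ 2 * E.
    rewrite -(cintZ _ c1).
    apply: le_trans (_ : _ <= 9 * e ^+ 2 * cint (fun x => cutoff e x ^+ 1 * (w x * N x))) _; last first.
      by rewrite ler_wpM2l ?energy // mulr_ge0 ?sqr_ge0.
    rewrite -(cintZ _ c3) -[leRHS]add0r -(@cutoff_divergence R n e 1 _ e0 Cflux).
    rewrite -(cintD c2 (cst _ _ c3)).
    apply: (cint_le (cst _ _ c1) (continuous_addf c2 (cst _ _ c3))) => x _.
    have [bx|bx] := boolP (s x < 1); first exact: pw.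
    by rewrite cutoff_flux_out // !cutoff_out1 // !mulr0 addr0.
  have : e ^+ 2 <= e by rewrite expr2 ler_piMl // ltW.
  have := energy_ge0; set I := cint _ => h1 h2 h3; nra.
move=> x i j bx.
have /eqP : curl_sq a x = 0.
  by have /eqP := B0 x bx; rewrite mulf_eq0 (gt_eqF (w'0 bx)) => /eqP.
rewrite psumr_eq0; last by move=> i' _; apply: sumr_ge0 => j' _; exact: sqr_ge0.
move=> /allP /(_ i); rewrite mem_index_enum => /(_ isT) /=.
rewrite psumr_eq0; last by move=> j' _; exact: sqr_ge0.
move=> /allP /(_ j); rewrite mem_index_enum => /(_ isT) /=.
by rewrite sqrf_eq0 subr_eq0 => /eqP.
Qed.

End Energy.

(** * The Pohozaev identity *)

Section Pohozaev.
Variables (R : realType) (n : nat).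
Local Notation pt := 'rV[R]_n.
Local Notation ball := (@ball_model R n).
Local Notation s := (@sqnorm R n).
Implicit Types x : pt.

Definition radial (a : 'I_n -> pt -> R) x : R := \sum_(j < n) a j x * x 0 j.

Variables (a : 'I_n -> pt -> R) (w : pt -> R) (E : R).
Hypothesis Ca : forall j, Ck ball 2 (a j).
Hypothesis Cw : Ck ball 1 w.
Hypothesis w0 : forall x, ball x -> 0 < w x.
Hypothesis energy : forall e, 0 < e ->
  cint (fun x => cutoff e x ^+ 1 * (w x * form_sq a x)) <= E.
Hypothesis dw : forall x i, ball x ->
  pd i w x = (n%:R - 2) * w x * (2 * x 0 i / (1 - s x)).
Hypothesis closed : forall x i j, ball x -> pd i (a j) x = pd j (a i) x.
Hypothesis coclosed : forall x, ball x ->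
  \sum_(i < n) pd i (fun y => w y * a i y) x = 0.

Local Notation N := (form_sq a).
Local Notation P := (radial a).

Let o := @open_ball_model R n.

Let CN k : (k <= 2)%N -> Ck ball k N.
Proof.
by move=> k2; apply: (Ck_sum o _ _) => j; exact: (Ck_exp o 2 (Ck_le k2 (Ca j))).
Qed.

Let CP : Ck ball 1 P.
Proof.
by apply: (Ck_sum o _ _) => j; exact: (Ck_mul o (Ck_pred (Ca j)) (Ck_coord o _ _)).
Qed.

(* The energy-momentum tensor of the form, contracted with the radial field
   [(1 - |x|^2) x]. *)
Let flux i x :=
  (1 - s x) * ((w x * a i x) * P x + -1 * ((2^-1 * (w x * N x)) * x 0 i)).

Let Cwa i : Ck ball 1 (fun x => w x * a i x).
Proof. exact: (Ck_mul o Cw (Ck_pred (Ca i))). Qed.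

Let CwN : Ck ball 1 (fun x => w x * N x).
Proof. exact: (Ck_mul o Cw (@CN 1 isT)). Qed.

Let CwNx i : Ck ball 1 (fun x => (2^-1 * (w x * N x)) * x 0 i).
Proof. exact: (Ck_mul o (Ck_mul o (Ck_cst o _ _) CwN) (Ck_coord o _ _)). Qed.

Let CT i : Ck ball 1 (fun x => (w x * a i x) * P x + -1 * ((2^-1 * (w x * N x)) * x 0 i)).
Proof. exact: (Ck_add o (Ck_mul o (Cwa i) CP) (Ck_mul o (Ck_cst o _ _) (CwNx i))). Qed.

Let Cflux i : Ck ball 1 (flux i).
Proof. exact: (Ck_mul o (@Ck_1sub R n 1) (CT i)). Qed.

Let der k f x i (Cf : Ck ball k.+1 f) (bx : ball x) := @Ck_derivable _ _ _ _ _ x i Cf bx.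

Let dP i x : ball x -> pd i P x = \sum_(j < n) pd i (a j) x * x 0 j + a i x.
Proof.
move=> bx; have da j := @der _ _ x i (Ca j) bx.
have dx j : derivable (fun y : pt => y 0 j) x (ej R i) by case: (is_derive_coord i j x).
rewrite pd_sum; last by move=> j; exact: derivable_mulf (da j) (dx j).
rewrite (eq_bigr (fun j => pd i (a j) x * x 0 j + a j x * (j == i)%:R)).
  rewrite big_split /=; congr (_ + _).
  by rewrite (bigD1 i) //= eqxx mulr1 big1 ?addr0 // => j /negPf ->; rewrite mulr0.
by move=> j _; rewrite (pdM (da j) (dx j)) pd_coord.
Qed.

Let dN i x : ball x -> pd i N x = 2 * \sum_(j < n) a j x * pd i (a j) x.
Proof.
move=> bx; have da j := @der _ _ x i (Ca j) bx.
have E2 : N = fun y => \sum_(j < n) a j y * a j y.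
  by apply/funext => y; apply: eq_bigr => j _; rewrite expr2.
rewrite E2 pd_sum; last by move=> j; exact: derivable_mulf (da j) (da j).
by rewrite mulr_sumr; apply: eq_bigr => j _; rewrite (pdM (da j) (da j)); ring.
Qed.

(** Coclosedness removes the divergence of [w a], and closedness cancels the two sums that contain
    derivatives of [a] ([sQ] below). The factor [1 - s x] of the field cancels the denominators that
    come from the cutoff and from the weight. What is left is algebraic in [a]. *)
Let div_flux e x : ball x ->
  \sum_(i < n) pd i (fun y => cutoff e y ^+ 2 * flux i y) x =
  - (4 * e * cutoff e x * w x * (P x ^+ 2 - 2^-1 * N x * s x))
  - cutoff e x ^+ 2 * w x *
    (((n%:R - 2) / 2 * (1 + s x) - s x) * N x + 2 * P x ^+ 2).
Proof.
move=> bx; have u0 := ball_neq0 bx.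
pose Q i := \sum_(j < n) pd i (a j) x * x 0 j.
pose Q' i := \sum_(j < n) a j x * pd i (a j) x.
have step i : pd i (fun y => cutoff e y ^+ 2 * flux i y) x =
    - (4 * e * cutoff e x * w x) * (a i x * x 0 i * P x - 2^-1 * N x * x 0 i ^+ 2)
    + cutoff e x ^+ 2 * (- 2 * w x * (a i x * x 0 i * P x - 2^-1 * N x * x 0 i ^+ 2)
      + (1 - s x) * (pd i (fun y => w y * a i y) x * P x
        + w x * (a i x * Q i + a i x ^+ 2)
        - (n%:R - 2) * w x * N x / (1 - s x) * x 0 i ^+ 2
        - w x * (x 0 i * Q' i) - 2^-1 * w x * N x)).
  have [dc _] := is_derive_cutoffX e 0 i bx.
  have dx : derivable (fun y : pt => y 0 i) x (ej R i) by case: (is_derive_coord i i x).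
  have d1 := @der _ _ x i CwN bx.
  rewrite (pdM dc (@der _ _ x i (Cflux i) bx)) (pd_cutoffX e 0 i bx).
  rewrite (pdM (@der _ _ x i (@Ck_1sub R n 1) bx) (@der _ _ x i (CT i) bx)) pd_1sub.
  rewrite (pdD (@der _ _ x i (Ck_mul o (Cwa i) CP) bx) (@der _ _ x i (Ck_mul o (Ck_cst o _ (-1)) (CwNx i)) bx)).
  rewrite (pdM (@der _ _ x i (Cwa i) bx) (@der _ _ x i CP bx)) (pdZ _ (@der _ _ x i (CwNx i) bx)).
  rewrite (pdM (@der _ _ x i (Ck_mul o (Ck_cst o _ (2^-1)) CwN) bx) dx) pd_coord eqxx (_ : true%:R = 1 :> R) //.
  rewrite (pdZ _ d1) (pdM (@der _ _ x i Cw bx) (@der _ _ x i (@CN 1 isT) bx)) (@dP i x bx) (@dN i x bx) (@dw x i bx).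
  rewrite /flux -/(Q i) -/(Q' i) expr1.

  by field.
have sQ : \sum_(i < n) a i x * Q i = \sum_(i < n) x 0 i * Q' i.
  rewrite /Q /Q'; under eq_bigr do rewrite mulr_sumr.
  rewrite exchange_big; apply: eq_bigr => i _; rewrite mulr_sumr.
  by apply: eq_bigr => j _; rewrite (@closed x i j bx); ring.
have sP : \sum_(i < n) (a i x * x 0 i * P x - 2^-1 * N x * x 0 i ^+ 2)
    = P x ^+ 2 - 2^-1 * N x * s x.
  by rewrite sumrB -mulr_suml -mulr_sumr expr2.
rewrite (eq_bigr _ (fun i _ => step i)) big_split /= -!mulr_sumr sP.
rewrite big_split /= -!mulr_sumr sP !sumrB big_split /= -mulr_suml (coclosed bx) mul0r add0r.
rewrite -!mulr_sumr big_split /= sQ.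
rewrite sumr_const card_ord -[\sum_(i < n) a i x ^+ 2]/(N x) -[\sum_(i < n) x 0 i ^+ 2]/(s x).
rewrite -[_ *+ n]mulr_natl.
by field.
Qed.

Lemma zero_of_closed_coclosed : (2 < n)%N ->
  forall x j, ball x -> a j x = 0.
Proof.
move=> n2; have n3 : (3 : R) <= n%:R by rewrite ler_nat.
pose G x := 2^-1 * ((1 - s x) * (w x * N x)).
have CG : Ck ball 0 G.
  exact: (Ck_mul o (Ck_cst o _ _) (Ck_mul o (@Ck_1sub R n 0) (Ck_pred CwN))).
have wN0 x : ball x -> 0 <= w x * N x.
  by move=> bx; exact: mulr_ge0 (ltW (w0 bx)) (form_sq_ge0 _ _).
have pw e x : 0 < e -> ball x ->
    cutoff e x ^+ 2 * G x <=
    -1 * (\sum_(i < n) pd i (fun y => cutoff e y ^+ 2 * flux i y) x)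
    + 2 * e * (cutoff e x ^+ 1 * (w x * N x)).
  move=> e0 bx; rewrite (div_flux e bx) expr1 /G.
  have c0 := cutoff_ge0 e x; have ww := w0 bx; have NN := form_sq_ge0 a x.
  have s0 := sqnorm_ge0 x; have u0 := ball_gt0 bx.
  have h1 : 0 <= cutoff e x ^+ 2 * w x *
      ((((n%:R - 2) / 2 * (1 + s x) - s x) - 2^-1 * (1 - s x)) * N x + 2 * P x ^+ 2).
    apply: mulr_ge0 (mulr_ge0 (sqr_ge0 _) (ltW ww)) _.
    apply: addr_ge0; last by apply: mulr_ge0 (sqr_ge0 _).
    apply: mulr_ge0 NN.
    (* What remains of the coefficient of [N x] once the share of [G] is subtracted: this is where
       [3 <= n] is decisive. *)
    have -> : (n%:R - 2) / 2 * (1 + s x) - s x - 2^-1 * (1 - s x)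
       = 2^-1 * ((n%:R - 3) * (1 + s x)) :> R by field.
    by rewrite !mulr_ge0 ?subr_ge0 // addr_ge0.
  (* In the cutoff term [P x ^+ 2] has the favourable sign. The part in [N x * s x] is compensated
     by the energy term, since [s x < 1]. *)
  have h2 : 0 <= 2 * e * cutoff e x * w x * (2 * P x ^+ 2 + N x * (1 - s x)).
    apply: mulr_ge0; first by apply: mulr_ge0 (ltW ww); rewrite !mulr_ge0 // ltW.
    apply: addr_ge0 (mulr_ge0 NN (ltW u0)).
    by apply: mulr_ge0 (sqr_ge0 _).
  rewrite -subr_ge0; apply: le_trans (addr_ge0 h1 h2) _.
  by rewrite le_eqVlt; apply/orP; left; apply/eqP; field.
have G0 : forall x, ball x -> G x = 0.
  apply: (@cutoff_vanish R n 1 G (2 * E)) => //.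
    by move=> x bx; rewrite /G !mulr_ge0 ?(ltW (ball_gt0 bx)) ?form_sq_ge0 ?(ltW (w0 bx)).
  move=> e /andP[e0 e1].
  have c1 := @cutoff_continuous R n e 1 _ e0 CG.
  have c2 := @cutoff_flux_continuous R n e 0 _ e0 Cflux.
  have c3 := @cutoff_continuous R n e 0 _ e0 (Ck_pred CwN).
  have cst (k : R) (f : pt -> R) : continuous f -> continuous (fun x => k * f x).
    by move=> cf; apply: continuous_mulf => //; exact: cst_continuous.
  apply: le_trans (_ : _ <= 2 * e * cint (fun x => cutoff e x ^+ 1 * (w x * N x))) _; last first.
    by rewrite [leRHS]mulrAC ler_wpM2l ?energy // mulr_ge0 // ltW.
  rewrite -(cintZ _ c3) -[leRHS]add0r -[X in X + _](mulr0 (-1)).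
  rewrite -(@cutoff_divergence R n e 0 _ e0 Cflux) -(cintZ _ c2).
  rewrite -(cintD (cst _ _ c2) (cst _ _ c3)).
  apply: (cint_le c1 (continuous_addf (cst _ _ c2) (cst _ _ c3))) => x _.
  have [bx|bx] := boolP (s x < 1); first exact: pw.
  by rewrite cutoff_flux_out // /cutoff (negPf bx) !exprS !mul0r !mulr0 addr0.
move=> x j bx.
have /eqP : N x = 0.
  have /eqP := G0 x bx; rewrite /G !mulf_eq0 invr_eq0 pnatr_eq0 /=.
  by rewrite (negPf (ball_neq0 bx)) (gt_eqF (w0 bx)) => /eqP.
rewrite psumr_eq0; last by move=> j' _; exact: sqr_ge0.
move=> /allP /(_ j); rewrite mem_index_enum => /(_ isT) /=.
by rewrite sqrf_eq0 => /eqP.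
Qed.

End Pohozaev.

(** * Hyperbolic space of dimension greater than two *)

Section Hyperbolic.
Variables (R : realType) (n : nat).
Local Notation pt := 'rV[R]_n.
Local Notation ball := (@ball_model R n).
Local Notation s := (@sqnorm R n).
Local Notation g := (@hypg R n).
Implicit Types (x : pt) (v : pt -> pt).

Let o := @open_ball_model R n.

Definition conf x : R := 2 / (1 - s x).

Lemma conf_gt0 x : ball x -> 0 < conf x.
Proof. by move=> bx; rewrite divr_gt0 // ball_gt0. Qed.

Lemma conf_neq0 x : ball x -> conf x != 0.
Proof. by move=> /conf_gt0 /gt_eqF ->. Qed.

Lemma conf_inv x : (conf x)^-1 = (1 - s x) / 2.
Proof. by rewrite /conf invf_div. Qed.

Lemma Ck_conf k : Ck ball k conf.
Proof.
apply: (Ck_mul o (Ck_cst o _ _) (Ck_inv o _ (@Ck_1sub R n k))).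
exact: ball_neq0.
Qed.

Lemma near_ball x (Q : pt -> Prop) : ball x -> (forall y, ball y -> Q y) ->
  \near x, Q x.
Proof. by move=> bx BQ; have := open_nbhs_nbhs (conj o bx); apply: filterS. Qed.

Lemma pd_conf i x : ball x -> pd i conf x = conf x * (2 * x 0 i / (1 - s x)).
Proof.
move=> bx; have u0 := ball_neq0 bx.
have d := @Ck_derivable _ _ _ _ _ x i (@Ck_1sub R n 1) bx.
have d' := @Ck_derivable _ _ _ _ _ x i (Ck_inv o (@ball_neq0 R n) (@Ck_1sub R n 1)) bx.
rewrite (pdZ _ d') (pdV u0 d) pd_1sub /conf.
by field.
Qed.

Lemma pd_confX m i x : ball x ->
  pd i (fun y => conf y ^+ m) x = m%:R * conf x ^+ m * (2 * x 0 i / (1 - s x)).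
Proof.
move=> bx; elim: m => [|m IH].
  by rewrite (_ : (fun y => _) = fun=> 1) ?pd_cst ?mul0r.
rewrite (_ : (fun y => _) = fun y => conf y * conf y ^+ m); last first.
  by apply/funext => y; rewrite exprS.
have d := @Ck_derivable _ _ _ _ _ x i (Ck_conf 1) bx.
have d' := @Ck_derivable _ _ _ _ _ x i (Ck_exp o m (Ck_conf 1)) bx.
rewrite (pdM d d') IH (pd_conf i bx) exprS -natr1.
by ring.
Qed.

Lemma hypg_scalar x : g x = (conf x ^+ 2)%:M.
Proof. by rewrite /hypg scalemx1. Qed.

Lemma ginv_scalar x : ginv g x = ((conf x ^+ 2)^-1)%:M.
Proof. by rewrite /ginv hypg_scalar invmx_scalar. Qed.

Lemma vol_conf x : ball x -> vol g x = conf x ^+ n.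
Proof.
move=> bx; rewrite /vol hypg_scalar det_scalar -exprM mulnC exprM sqrtr_sqr.
by rewrite ger0_norm // exprn_ge0 // ltW // conf_gt0.
Qed.

Lemma sum_scalarl (c : R) i (f : 'I_n -> R) :
  \sum_(j < n) (c%:M : 'M[R]_n) i j * f j = c * f i.
Proof.
rewrite (bigD1 i) //= mxE eqxx mulr1n big1 ?addr0 // => j ji.
by rewrite mxE eq_sym (negPf ji) mulr0n mul0r.
Qed.

Lemma comp_flat v i : Defs.comp (flat g v) i = fun x => conf x ^+ 2 * v x 0 i.
Proof.
by apply/funext => x; rewrite /Defs.comp /flat mxE hypg_scalar sum_scalarl.
Qed.

Lemma sharp_flat v x : ball x -> sharp g (flat g v) x = v x.
Proof.
move=> bx; apply/rowP => i; rewrite /sharp mxE ginv_scalar sum_scalarl.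
rewrite mxE hypg_scalar sum_scalarl mulKf //.
by rewrite expf_neq0 // conf_neq0.
Qed.

Lemma pd_near_ball i (f h : pt -> R) x : ball x -> (forall y, ball y -> f y = h y) ->
  pd i f x = pd i h x.
Proof. by move=> bx fh; apply: pd_near_eq; exact: near_ball. Qed.

Lemma codiff1_flat v x : ball x -> codiff1 g (flat g v) x = - divg g v x.
Proof.
move=> bx; rewrite /codiff1 /divg; congr (- (_ * _)).
apply: eq_bigr => i _; apply: pd_near_ball => // y by_.
by rewrite sharp_flat.
Qed.

Lemma vol_comp v i x : (2 <= n)%N -> ball x ->
  vol g x * v x 0 i = conf x ^+ (n - 2) * Defs.comp (flat g v) i x.
Proof.
by move=> n2 bx; rewrite vol_conf // comp_flat mulrA -exprD subnK.
Qed.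

(** The volume density times two inverse metrics is [conf] to the power [n - 4]. It is written as
    [conf ^+ (n - 2)] times [conf ^- 2], because [n - 4] would be truncated at zero for [n = 2] and
    [n = 3]. *)
Lemma codiff2_d1 v j x : (2 <= n)%N -> ball x ->
  codiff2 g (d1 (flat g v)) x 0 j =
  - (conf x ^+ 2 * (conf x ^+ n)^-1) *
  \sum_(i < n) pd i (fun y => weight2 (fun z => conf z ^+ (n - 2)) y *
                              curl (Defs.comp (flat g v)) i j y) x.
Proof.
move=> n2 bx; rewrite /codiff2 mxE hypg_scalar sum_scalarl vol_conf //.
rewrite mulrA mulrN; congr (_ * _).
apply: eq_bigr => i _; apply: pd_near_ball => // y by_.
rewrite vol_conf // ginv_scalar.
under eq_bigr => k _ do (under eq_bigr => c _ do rewrite -mulrA; rewrite -mulr_sumr sum_scalarl).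
rewrite sum_scalarl mxE /curl /weight2 -conf_inv -{1}(subnK n2) exprD.
have l0 := conf_neq0 by_; set X := _ - _.
by field.
Qed.

Lemma gnorm2_vol v x : (2 <= n)%N -> ball x ->
  gnorm2 g v x * vol g x =
  conf x ^+ (n - 2) * form_sq (Defs.comp (flat g v)) x.
Proof.
move=> n2 bx; rewrite vol_conf // /gnorm2 hypg_scalar.
under eq_bigr => i _ do (under eq_bigr => j _ do rewrite -mulrA; rewrite sum_scalarl).
rewrite -mulr_sumr /form_sq (_ : conf x ^+ n = conf x ^+ (n - 2) * conf x ^+ 2); last first.
  by rewrite -exprD subnK.
under [in RHS]eq_bigr do rewrite comp_flat exprMn.
rewrite -mulr_sumr; under eq_bigr do rewrite -expr2.
by ring.
Qed.

Lemma no_L2_harmonic v : (2 < n)%N -> hyp_sol v -> forall x, ball x -> v x = 0.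
Proof.
move=> n3 [[sv [divv _]] [harm l2]]; have n2 := ltnW n3.
pose a := Defs.comp (flat g v); pose w x := conf x ^+ (n - 2).
have Cw k : Ck ball k w := Ck_exp o _ (Ck_conf k).
have w0 x : ball x -> 0 < w x by move=> bx; rewrite exprn_gt0 // conf_gt0.
have Ca k j : Ck ball k (a j).
  by rewrite /a comp_flat; exact: (Ck_mul o (Ck_exp o 2 (Ck_conf k)) (smooth_on_Ck k (sv j))).
have coclosed x : ball x -> \sum_(i < n) pd i (fun y => w y * a i y) x = 0.
  move=> bx; have /eqP := divv x bx.
  rewrite /divg mulf_eq0 invr_eq0 vol_conf // expf_eq0 (negPf (conf_neq0 bx)) andbF /= => /eqP H; rewrite -[RHS]H.
  apply: eq_bigr => i _; apply: pd_near_ball => // y by_.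
  by rewrite vol_comp.
(* As [v] is divergence free, [delta a] vanishes on the whole ball, so [d delta a] drops out of the
   Laplacian and leaves [delta d a = 0]. *)
have coclosed2 x j : ball x ->
    \sum_(i < n) pd i (fun y => weight2 w y * curl a i j y) x = 0.
  move=> bx; have := harm x bx; rewrite /hodge_lap1 => /rowP /(_ j).
  rewrite mxE [X in _ + X]codiff2_d1 // [X in X + _]mxE [X in X + _](_ : _ = 0).
    rewrite add0r mxE => /eqP; rewrite mulf_eq0 oppr_eq0 mulf_eq0 invr_eq0 !expf_eq0.
    by rewrite (negPf (conf_neq0 bx)) !andbF /= => /eqP.
  rewrite -(pd_cst j 0 x); apply: pd_near_ball => // y by_.
  by rewrite codiff1_flat // divv // oppr0.
pose h x := if `[< ball x >] then (gnorm2 g v x * vol g x)%:E else 0%E.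
have h0 x : (0 <= h x)%E.
  rewrite /h; case: asboolP => // bx; rewrite gnorm2_vol // lee_fin.
  exact: mulr_ge0 (ltW (w0 x bx)) (form_sq_ge0 _ _).
(* The squared L2 norm itself serves as the energy bound: since the cutoff is at most [1], the
   integrand is a continuous minorant of [h] on the cube. *)
have energy e : 0 < e ->
    cint (fun x => cutoff e x ^+ 1 * (w x * form_sq a x)) <= fine (iint h).
  move=> e0; rewrite -lee_fin fineK; last first.
    by rewrite ge0_fin_numE //; exact: iint_ge0.
  have CwN : Ck ball 0 (fun x => w x * form_sq a x).
    apply: (Ck_mul o (Cw 0)); apply: (Ck_sum o _ _) => j; exact: (Ck_exp o 2 (Ca 0 j)).
  have wN0 x : ball x -> 0 <= w x * form_sq a x.
    by move=> bx; exact: mulr_ge0 (ltW (w0 x bx)) (form_sq_ge0 _ _).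
  apply: cint_le_iint (@cutoff_continuous R n e 0 _ e0 CwN) h0 _ _ => x _.
    rewrite expr1; have [bx|bx] := boolP (s x < 1).
      by exact: mulr_ge0 (cutoff_ge0 _ _) (wN0 x bx).
    by rewrite /cutoff (negPf bx) mul0r.
  rewrite expr1 /h; case: asboolP => bx.
    rewrite gnorm2_vol // lee_fin ler_piMl //; first exact: wN0.
    by rewrite cutoff_le1 // ltW.
  by rewrite /cutoff ifF ?mul0r //; apply/negP.
have closed := closed_of_coclosed2 (Ca 2) (Cw 1) w0 energy (fun x j => @coclosed2 x j).
have dw x i : ball x -> pd i w x = (n%:R - 2) * w x * (2 * x 0 i / (1 - s x)).
  by move=> bx; rewrite /w pd_confX // natrB.
move=> x bx; apply/rowP => j; rewrite mxE.
have /eqP := zero_of_closed_coclosed (Ca 2) (Cw 1) w0 energy dw closed coclosed n3 j bx.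
by rewrite /a comp_flat mulf_eq0 expf_eq0 (negPf (conf_neq0 bx)) /= => /eqP.
Qed.

End Hyperbolic.

(** * The hyperbolic plane *)

Section PolyFun.
Variables (R : realType) (n : nat).
Local Notation pt := 'rV[R]_n.

(** On the disc all the fields are polynomial in the coordinates, the inverse conformal factor
    included. Smoothness and boundedness on the cube then follow by structural induction. *)
Inductive polyfun : (pt -> R) -> Prop :=
| polyfun_cst c : polyfun (fun=> c)
| polyfun_coord i : polyfun (fun x => x 0 i)
| polyfun_add f g : polyfun f -> polyfun g -> polyfun (fun x => f x + g x)
| polyfun_mul f g : polyfun f -> polyfun g -> polyfun (fun x => f x * g x).

Lemma polyfun_sum m (f : 'I_m -> pt -> R) : (forall k, polyfun (f k)) ->
  polyfun (fun x => \sum_(k < m) f k x).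
Proof.
move=> pf; elim: (index_enum _) => [|k r IH].
  by under eq_fun do rewrite big_nil; exact: polyfun_cst.
by under eq_fun do rewrite big_cons; exact: polyfun_add.
Qed.

Lemma polyfun_differentiable f x : polyfun f -> differentiable f x.
Proof.
elim=> [c|i|f' g _ df _ dg|f' g _ df _ dg].
- exact: differentiable_cst.
- exact: differentiable_coord.
- exact: differentiableD.
- exact: differentiableM.
Qed.

Lemma polyfun_derivable f x i : polyfun f -> derivable f x (ej R i).
Proof. by move=> pf; apply: diff_derivable; exact: polyfun_differentiable. Qed.

Lemma polyfun_pd f i : polyfun f -> polyfun (pd i f).
Proof.
elim=> [c|j|f' g pf IHf pg IHg|f' g pf IHf pg IHg].
- rewrite (_ : pd i _ = fun=> 0); first exact: polyfun_cst.
  by apply/funext => x; rewrite pd_cst.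
- rewrite (_ : pd i _ = fun=> (j == i)%:R); first exact: polyfun_cst.
  by apply/funext => x; rewrite pd_coord.
- rewrite (_ : pd i _ = fun x => pd i f' x + pd i g x); first exact: polyfun_add.
  apply/funext => x.
  by rewrite (pdD (@polyfun_derivable _ x i pf) (@polyfun_derivable _ x i pg)).
- rewrite (_ : pd i _ = fun x => pd i f' x * g x + f' x * pd i g x).
    by apply: polyfun_add; exact: polyfun_mul.
  apply/funext => x.
  by rewrite (pdM (@polyfun_derivable _ x i pf) (@polyfun_derivable _ x i pg)).
Qed.

Lemma polyfun_smooth_on U f : polyfun f -> smooth_on U f.
Proof.
move=> pf l x _; apply: polyfun_differentiable.
by elim: l => //= i l; exact: polyfun_pd.
Qed.

Lemma polyfun_bounded f : polyfun f -> exists M, forall x, cube x -> `|f x| <= M.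
Proof.
elim=> [c|i|f' g _ [M HM] _ [M' HM']|f' g _ [M HM] _ [M' HM']].
- by exists `|c|.
- by exists 1 => x /(_ i); rewrite ler_norml.
- by exists (M + M') => x cx; rewrite (le_trans (ler_normD _ _)) // lerD ?HM ?HM'.
- by exists (M * M') => x cx; rewrite normrM ler_pM ?HM ?HM'.
Qed.

Lemma polyfun_sqnorm : polyfun (@sqnorm R n).
Proof.
apply: polyfun_sum => k; rewrite (_ : (fun x => _) = fun x : pt => x 0 k * x 0 k).
  by apply: polyfun_mul; exact: polyfun_coord.
by apply/funext => x; rewrite expr2.
Qed.

Lemma ball_cube x : @ball_model R n x -> cube x.
Proof.
move=> bx i; rewrite -ler_norml -(@expr_le1 _ 2) // real_normK ?num_real //.
exact: le_trans (coord_le_sqnorm x i) (ltW bx).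
Qed.

End PolyFun.

(** * Upper bounds for the iterated Lebesgue integral *)

Section IintBound.
Variable R : realType.

Lemma iint0 n : iint (fun _ : 'rV[R]_n => 0%E) = 0%E.
Proof. by elim: n => [//|n IH] /=; rewrite integral0_eq. Qed.

Lemma iint_cube_bounded n (h : 'rV[R]_n -> \bar R) (M : R) : 0 <= M ->
  (forall x, (0 <= h x)%E) -> (forall x, cube x -> (h x <= M%:E)%E) ->
  (forall x, ~ cube x -> h x = 0%E) -> (iint h <= (2 ^+ n * M)%:E)%E.
Proof.
elim: n h M => [|n IH] h M M0 h0 hM hout /=.
  by rewrite mul1r; apply: hM => -[].
have c0 : 0 <= 2 ^+ n * M by rewrite mulr_ge0 // exprn_ge0.
have -> : (2 ^+ n.+1 * M)%:E =
    (\int[@lebesgue_measure R]_(t in `[(-1)%R, 1%R]) (2 ^+ n * M)%R%:E)%E.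
  rewrite integral_cst //= lebesgue_measure_itv /= lte_fin ifT; last lra.
  by rewrite -EFinM exprS; congr EFin; lra.
rewrite [leRHS]integral_mkcond; apply: ge0_integral_mono => t; first by apply: iint_ge0.
rewrite patchE; case: ifPn => [t1|t1].
  apply: IH => // [x cx|x cx].
    have [ct|ct] := pselect (cube (vcons t x)); first exact: hM.
    by rewrite hout ?lee_fin.
  apply: hout => cv; apply: cx => i; have := cv (rshift 1 i).
  by rewrite vconsS.
rewrite [X in (X <= _)%E](_ : _ = 0%E) // -[RHS](iint0 n).
congr iint; apply/funext => y; apply: hout => cv.
move/negP : t1; apply; rewrite inE /= in_itv /=.
by have := cv ord0; rewrite vcons0.
Qed.

End IintBound.

(** * Solutions on the disc from powers of the complex variable *)

Section Disc.
Variable R : realType.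
Local Notation pt := 'rV[R]_2.
Local Notation ball := (@ball_model R 2).
Local Notation s := (@sqnorm R 2).
Local Notation g := (@hypg R 2).
Implicit Types x : pt.

(* The inverse conformal factor, written so as to be visibly polynomial. *)
Definition coconf x : R := 4^-1 * ((1 + -1 * s x) * (1 + -1 * s x)).

Lemma coconfE x : coconf x = (conf x ^+ 2)^-1.
Proof. by rewrite -exprVn conf_inv /coconf; field. Qed.

Lemma polyfun_coconf : polyfun coconf.
Proof.
have p : polyfun (fun x : pt => 1 + -1 * s x).
  apply: polyfun_add; first exact: polyfun_cst.
  by apply: polyfun_mul; [exact: polyfun_cst|exact: polyfun_sqnorm].
by apply: polyfun_mul; [exact: polyfun_cst|exact: polyfun_mul].
Qed.

Lemma pd_coconf i x : pd i coconf x = - (1 - s x) * x 0 i.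
Proof.
have p : polyfun (fun x : pt => 1 + -1 * s x).
  apply: polyfun_add; first exact: polyfun_cst.
  by apply: polyfun_mul; [exact: polyfun_cst|exact: polyfun_sqnorm].
have d := @polyfun_derivable _ _ _ x i p.
have E : (fun x : pt => 1 + -1 * s x) = fun x => 1 - s x.
  by apply/funext => y; rewrite mulN1r.
rewrite (pdZ _ (derivable_mulf d d)) (pdM d d) E pd_1sub.
by field.
Qed.

Lemma christoffel_hypg k i j x : ball x ->
  christoffel g k i j x = 2 / (1 - s x) *
   ((j == k)%:R * x 0 i + (i == k)%:R * x 0 j - (i == j)%:R * x 0 k).
Proof.
move=> bx; rewrite /christoffel ginv_scalar sum_scalarl.
have dg (i' j' l : 'I_2) : pd i' (fun y => g y j' l) x =
    (j' == l)%:R * (2 * conf x ^+ 2 * (2 * x 0 i' / (1 - s x))).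
  have d := @Ck_derivable _ _ _ _ _ x i' (Ck_exp (@open_ball_model R 2) 2 (@Ck_conf R 2 1)) bx.
  rewrite -(pd_confX 2 i' bx) -(pdZ _ d); congr (pd _ _ _).
  by apply/funext => y; rewrite hypg_scalar mxE mulr_natl.
rewrite !dg; have := conf_neq0 bx => l0.
by field; rewrite l0 ball_neq0.
Qed.

Lemma harmonic_sol (a : 'I_2 -> pt -> R) (v : pt -> pt) :
  (forall x i, v x 0 i = coconf x * a i x) ->
  (forall i, polyfun (a i)) ->
  (forall i j x, pd i (a j) x = pd j (a i) x) ->
  (forall x, \sum_(i < 2) pd i (a i) x = 0) -> hyp_sol v.
Proof.
move=> vE pa closed coclosed.
have flatE x i : ball x -> Defs.comp (flat g v) i x = a i x.
  move=> bx; rewrite comp_flat vE coconfE mulVKf // expf_neq0 //.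
  exact: conf_neq0.
have vi i : Defs.comp v i = fun x => coconf x * a i x.
  by apply/funext => x; exact: vE.
have divv x : ball x -> divg g v x = 0.
  move=> bx; rewrite /divg [X in _ * X](_ : _ = 0) ?mulr0 // -[RHS](coclosed x).
  apply: eq_bigr => i _; apply: pd_near_ball => // y by_.
  by rewrite vol_comp // expr0 mul1r flatE.
split; [split; [|split => //]|split].
- by move=> i; rewrite vi; apply: polyfun_smooth_on; exact: polyfun_mul polyfun_coconf (pa i).
- pose q x := \sum_(i < 2) a i x * a i x.
  have pq : polyfun q by apply: polyfun_sum => i; exact: polyfun_mul.
  have pcq : polyfun (fun x => coconf x * q x) := polyfun_mul polyfun_coconf pq.
  (* This is [- |v|^2 / 2]: as [v] is [coconf] times [a], its squared hyperbolic length is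
     [coconf * q]. *)
  exists (fun x => - 2^-1 * (coconf x * q x)); split.
    by move=> x _; apply: polyfun_differentiable; exact: polyfun_mul (polyfun_cst _ _) pcq.
  move=> x bx; apply/rowP => k; rewrite !mxE ginv_scalar sum_scalarl -coconfE.
  have dc i := @polyfun_derivable _ _ _ x i polyfun_coconf.
  have da j i := @polyfun_derivable _ _ _ x i (pa j).
  have dq i : pd i q x = 2 * \sum_(j < 2) a j x * pd j (a i) x.
    rewrite pd_sum => [|j]; last exact: derivable_mulf (da j i) (da j i).
    rewrite mulr_sumr; apply: eq_bigr => j _.
    by rewrite (pdM (da j i) (da j i)) closed; ring.
  rewrite (pdZ _ (@polyfun_derivable _ _ _ x k pcq)).
  rewrite (pdM (dc k) (@polyfun_derivable _ _ _ x k pq)) pd_coconf dq.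
  have E1 : \sum_(i < 2) v x 0 i * pd i (Defs.comp v k) x =
      coconf x * (\sum_(i < 2) a i x * (- (1 - s x) * x 0 i * a k x + coconf x * pd i (a k) x)).
    rewrite mulr_sumr; apply: eq_bigr => i _.
    by rewrite vi (pdM (dc i) (da k i)) pd_coconf vE; ring.
  have E2 : \sum_(i < 2) \sum_(j < 2) christoffel g k i j x * v x 0 i * v x 0 j =
      \sum_(i < 2) \sum_(j < 2) 2 / (1 - s x) *
       ((j == k)%:R * x 0 i + (i == k)%:R * x 0 j - (i == j)%:R * x 0 k) *
       (coconf x * a i x) * (coconf x * a j x).
    by apply: eq_bigr => i _; apply: eq_bigr => j _; rewrite christoffel_hypg // !vE.
  rewrite E1 E2 /q !big_ord_recl !big_ord0 /=.
  have u0 := ball_neq0 bx.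
  have -> : coconf x = ((1 - s x) / 2) ^+ 2 by rewrite coconfE -exprVn conf_inv.
  have kE (i : 'I_2) : i = ord0 \/ i = lift ord0 ord0.
    by case: i => -[|[|//]] p; [left|right]; apply: val_inj.
  move: (1 - s x) u0 => u u0.
  clear E1 E2; case: (kE k) => {k}->; rewrite /=; by field.
- move=> x bx; rewrite /hodge_lap1; apply/rowP => j.
  rewrite mxE [X in _ + X]codiff2_d1 // [X in X + _]mxE [X in X + _](_ : _ = 0).
    rewrite add0r mxE big1 ?mulr0 // => i _.
    rewrite -(pd_cst i 0 x); apply: pd_near_ball => // y by_.
    rewrite /curl (@pd_near_ball _ _ i _ (a j)) // => [|z bz]; last exact: flatE.
    rewrite (@pd_near_ball _ _ j _ (a i)) // => [|z bz]; last exact: flatE.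
    by rewrite closed subrr mulr0.
  rewrite -(pd_cst j 0 x); apply: pd_near_ball => // y by_.
  by rewrite codiff1_flat // divv // oppr0.
- have [M HM] := polyfun_bounded (polyfun_sum (fun i => polyfun_mul (pa i) (pa i))).
  have M0 : 0 <= M by apply: le_trans (HM 0 _); [exact: normr_ge0|move=> i; rewrite mxE lerN10 ler01].
  have E x : ball x -> gnorm2 g v x * vol g x = \sum_(i < 2) a i x * a i x.
    move=> bx; rewrite gnorm2_vol // expr0 mul1r /form_sq.
    by apply: eq_bigr => i _; rewrite flatE // expr2.
  apply: le_lt_trans (_ : _ <= (2 ^+ 2 * M)%:E)%E (ltry _).
  apply: iint_cube_bounded => // [x|x cx|x cx]; case: asboolP => // bx.
  + by rewrite E // lee_fin; apply: sumr_ge0 => i _; rewrite -expr2 sqr_ge0.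
  + by rewrite E // lee_fin; apply: le_trans (ler_norm _) (HM x cx).
  + by case: cx; exact: ball_cube.
Qed.

(* The real and imaginary parts of [z ^ k], [z = x_0 + i x_1]. *)
Fixpoint zpow k : (pt -> R) * (pt -> R) :=
  match k with
  | 0 => (fun=> 1, fun=> 0)
  | k'.+1 => (fun x => x 0 ord0 * (zpow k').1 x + -1 * (x 0 ord_max * (zpow k').2 x),
              fun x => x 0 ord0 * (zpow k').2 x + x 0 ord_max * (zpow k').1 x)
  end.

(* The differential of [Re (z ^ k.+1 / k.+1)]. *)
Definition zform k (i : 'I_2) x : R :=
  if i == ord0 then (zpow k).1 x else -1 * (zpow k).2 x.

Definition zfield k x : pt := \row_i (coconf x * zform k i x).

Lemma polyfun_zpow k : polyfun (zpow k).1 /\ polyfun (zpow k).2.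
Proof.
elim: k => [|k [p1 p2]] /=; first by split; exact: polyfun_cst.
have pc := @polyfun_coord R 2.
split; first by do ?[exact: polyfun_mul|apply: polyfun_add|apply: polyfun_mul (polyfun_cst _ _) _].
by apply: polyfun_add; exact: polyfun_mul.
Qed.

Lemma polyfun_zform k i : polyfun (zform k i).
Proof.
rewrite /zform; have [p1 p2] := polyfun_zpow k.
by case: (i == ord0) => //; exact: polyfun_mul (polyfun_cst _ _) p2.
Qed.

(** Induction by the product rule for [z * z ^ k]. The first equation is the coclosedness of
    [zform k], the second its closedness. *)
Lemma cauchy_riemann k x : pd ord0 (zpow k).1 x = pd ord_max (zpow k).2 x /\
  pd ord_max (zpow k).1 x = - pd ord0 (zpow k).2 x.
Proof.
elim: k => [|k [e1 e2]] /=; first by rewrite !pd_cst oppr0.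
have [p1 p2] := polyfun_zpow k.
have dp f i := @polyfun_derivable R 2 f x i.
have dc j i := dp _ i (@polyfun_coord R 2 j).
have m j f i (pf : polyfun f) := derivable_mulf (dc j i) (dp f i pf).
have pm j f (pf : polyfun f) := polyfun_mul (@polyfun_coord R 2 j) pf.
have D1 i : pd i (fun x => x 0 ord0 * (zpow k).1 x + -1 * (x 0 ord_max * (zpow k).2 x)) x =
    (ord0 == i)%:R * (zpow k).1 x + x 0 ord0 * pd i (zpow k).1 x
    - ((ord_max == i)%:R * (zpow k).2 x + x 0 ord_max * pd i (zpow k).2 x).
  have pn := polyfun_mul (polyfun_cst _ (-1)) (pm ord_max _ p2).
  rewrite (pdD (m ord0 _ i p1) (dp _ i pn)) (pdZ _ (m ord_max _ i p2)).
  by rewrite (pdM (dc ord0 i) (dp _ i p1)) (pdM (dc ord_max i) (dp _ i p2)) !pd_coord mulN1r.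
have D2 i : pd i (fun x => x 0 ord0 * (zpow k).2 x + x 0 ord_max * (zpow k).1 x) x =
    (ord0 == i)%:R * (zpow k).2 x + x 0 ord0 * pd i (zpow k).2 x
    + ((ord_max == i)%:R * (zpow k).1 x + x 0 ord_max * pd i (zpow k).1 x).
  rewrite (pdD (m ord0 _ i p2) (m ord_max _ i p1)).
  by rewrite (pdM (dc ord0 i) (dp _ i p2)) (pdM (dc ord_max i) (dp _ i p1)) !pd_coord.
rewrite !D1 !D2 e1 e2 !eqxx /=.
by split; ring.
Qed.

Lemma zform_closed k i j x : pd i (zform k j) x = pd j (zform k i) x.
Proof.
have [e1 e2] := cauchy_riemann k x; have [_ p2] := polyfun_zpow k.
have dz i' := pdZ (-1) (@polyfun_derivable R 2 _ x i' p2).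
have H (i' : 'I_2) : i' = ord0 \/ i' = ord_max.
  by case: i' => -[|[|//]] p; [left|right]; apply: val_inj.
have z0 : zform k ord0 = (zpow k).1 by apply/funext => y; rewrite /zform eqxx.
have z1 : zform k ord_max = fun y => -1 * (zpow k).2 y by apply/funext.
by case: (H i) => ->; case: (H j) => -> //; rewrite z0 z1 dz e2 mulN1r.
Qed.

Lemma zform_coclosed k x : \sum_(i < 2) pd i (zform k i) x = 0.
Proof.
have [e1 e2] := cauchy_riemann k x; have [_ p2] := polyfun_zpow k.
have dz i' := pdZ (-1) (@polyfun_derivable R 2 _ x i' p2).
have z0 : zform k ord0 = (zpow k).1 by apply/funext => y; rewrite /zform eqxx.
have z1 : zform k ord_max = fun y => -1 * (zpow k).2 y by apply/funext.
rewrite big_ord_recr big_ord_recr big_ord0 /= add0r z1 dz mulN1r.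
rewrite (_ : widen_ord _ _ = ord0); last exact: val_inj.
by rewrite z0 e1 subrr.
Qed.

(** The Euler equations are quadratic, but being closed and coclosed are linear conditions on the
    form, so [harmonic_sol] applies to every linear combination. *)
Lemma zfield_sol m (c : 'I_m -> R) : hyp_sol (fun x => \sum_(k < m) c k *: zfield k x).
Proof.
pose a i x := \sum_(k < m) c k * zform k i x.
have dz i j k x := @polyfun_derivable R 2 _ x i (polyfun_zform k j).
have da i j x : pd i (a j) x = \sum_(k < m) c k * pd i (zform k j) x.
  rewrite pd_sum => [|k]; last exact: derivable_mulf (@derivable_cstf _ _ i (c k) x) (dz i j k x).
  by apply: eq_bigr => k _; rewrite (pdZ _ (dz i j k x)).
apply: (@harmonic_sol a) => [x i|i|i j x|x].
- rewrite summxE mulr_sumr; apply: eq_bigr => k _.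
  by rewrite !mxE mulrCA.
- apply: polyfun_sum => k; exact: polyfun_mul (polyfun_cst _ _) (polyfun_zform k i).
- by rewrite !da; apply: eq_bigr => k _; rewrite zform_closed.
- under eq_bigr do rewrite da.
  rewrite exchange_big big1 // => k _.
  by rewrite -mulr_sumr zform_coclosed mulr0.
Qed.

Lemma zpow_axis k x : x 0 ord_max = 0 -> (zpow k).1 x = x 0 ord0 ^+ k.
Proof.
by move=> x1; elim: k => [|k IH] /=; rewrite ?expr0 // x1 IH exprS mul0r mulr0 addr0.
Qed.

(** On the real axis the first component of [zfield k] is [coconf] times [t ^+ k]. A vanishing
    combination therefore gives a polynomial of size at most [m] that vanishes on the interval []0,
    1[]. *)
Lemma zfield_free m (c : 'I_m -> R) :
  (forall x, ball x -> \sum_(k < m) c k *: zfield k x = 0) -> forall k, c k = 0.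
Proof.
move=> c0; pose c' i := oapp c 0 (insub i).
have c'E (k : 'I_m) : c' k = c k by rewrite /c' valK.
pose p := \poly_(i < m) c' i.
suff p0 : p = 0.
  by move=> k; have := coef_poly m c' k; rewrite -/p p0 coef0 ltn_ord c'E.
(* These are [m] distinct points, one root more than a nonzero polynomial of size at most [m] can
   have; the shift by two keeps them below [1], inside the disc. *)
pose rs : seq R := [seq (j.+2)%:R^-1 | j <- iota 0 m].
apply: (@roots_geq_poly_eq0 _ p rs).
- apply/allP => _ /mapP[j _ ->]; set t := _^-1.
  have t0 : 0 < t by rewrite invr_gt0.
  have t1 : t < 1 by rewrite invf_lt1 // ltr1n.
  pose x : pt := \row_i (if i == ord0 then t else 0).
  have x0 : x 0 ord0 = t by rewrite mxE.
  have x1 : x 0 ord_max = 0 by rewrite mxE.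
  have bx : ball x.
    rewrite /ball_model /= /sqnorm big_ord_recr big_ord_recr big_ord0 /= add0r x1.
    rewrite (_ : widen_ord _ _ = ord0); last exact: val_inj.
    by rewrite x0 expr0n addr0 expr_lt1 // ltW.
  have /rowP /(_ ord0) := c0 x bx; rewrite summxE mxE => H.
  have : coconf x * p.[t] = 0.
    rewrite -[RHS]H horner_poly mulr_sumr; apply: eq_bigr => k _.
    by rewrite !mxE /zform eqxx zpow_axis // x0 c'E mulrCA.
  move=> /eqP; rewrite coconfE mulf_eq0 invr_eq0 expf_eq0 (negPf (conf_neq0 bx)) /=.
  by rewrite rootE.
- rewrite map_inj_uniq ?iota_uniq // => j j' /invr_inj /eqP.
  by rewrite eqr_nat => /eqP [].
- by rewrite size_map size_iota size_poly.
Qed.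

End Disc.

Theorem theorem1p1 (R : realType) :
  (* (i) an infinite linearly independent family spanning a space of solutions on H^2 *)
  (exists V : nat -> ('rV[R]_2 -> 'rV[R]_2),
     (forall (m : nat) (c : 'I_m -> R),
        hyp_sol (fun x => \sum_(k < m) c k *: V k x)) /\
     (forall (m : nat) (c : 'I_m -> R),
        (forall x, ball_model x -> \sum_(k < m) c k *: V k x = 0) ->
        forall k, c k = 0)) /\
  (* (ii) no nonzero solutions on H^n, n > 2 *)
  (forall (n : nat), (2 < n)%N ->
     forall v : 'rV[R]_n -> 'rV[R]_n, hyp_sol v ->
     forall x, ball_model x -> v x = 0).
Proof.
split; last by move=> n n2 v sv x; exact: (no_L2_harmonic n2 sv).
exists (@zfield R); split; [exact: zfield_sol|exact: zfield_free].
Qed.
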